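(* Let $I,J$ be disjoint index sets and let $K,K'$ be index sets. For each $k\in K$ let $C_k=(c_{i,j;k})_{i,j\in I\cup J}$ be a positive definite matrix with real entries. For each $N\in\mathbb{N}$, $k\in K$ and $l\in I\cup J$ let $Y_N^{l,k}=[x^{l,k}_{i,j;N}]_{i,j=1}^N$ be an $N\times N$ matrix with entries in $L^{\infty-}(\Omega,\mu)$, such that: (1) $E(x^{l,k}_{i,j;N})=0$ for all $1\le i,j\le N$, $l\in I\cup J$, $k\in K$; (2) $x^{l,k}_{j,i;N}=\overline{x^{l,k}_{i,j;N}}$ for all $1\le i,j\le N$, $l\in I\cup J$, $k\in K$; (3) for each $N$, $\{\{x^{l,k}_{i,j;N}:l\in I\cup J,\ k\in K\}:1\le i\le j\le N\}$ is an independent family of sets of random variables; (4) $E(x^{l_1,k}_{i,j;N}x^{l_2,k}_{j,i;N})=\frac1N c_{l_1,l_2;k}$ for all $1\le i,j\le N$, $l_1,l_2\in I\cup J$, $k\in K$, and $E(x^{l_1,k_1}_{i,j;N}x^{l_2,k_2}_{j,i;N})=0$ for all $1\le i,j\le N$, $l_1,l_2\in I\cup J$ and $k_1\neq k_2$ in $K$; (5) for every $m\in\mathbb{N}$ and all functions $\chi:\{1,\dots,m\}\to I\cup J$, $\epsilon:\{1,\dots,m\}\to K$ there exist a constant $M(\chi,\epsilon,m)>0$ and $N_0\in\mathbb{N}$ such that, whenever $N>N_0$, $$\sup_{1\le i\le j\le N}|E(x^{\chi(1),\epsilon(1)}_{\lambda(1),\tau(1);N}\cdots x^{\chi(m),\epsilon(m)}_{\lambda(m),\tau(m);N})|\le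 M(\chi,\epsilon,m)N^{-m/2},$$ where $(\lambda(l),\tau(l))=(i,j)$ or $(j,i)$ for $l=1,\dots,m$. For $k'\in K'$ and $N\in\mathbb{N}$ let $D_{k',N}=\mathrm{diag}(d^{k'}_{1,N},\dots,d^{k'}_{N,N})\in M_N(\mathbb{C})$ be constant diagonal matrices such that, as $N\to\infty$, the joint distribution of $\{D_{k',N}:k'\in K'\}$ (with respect to $\frac1N\mathrm{Tr}$) converges to that of a family $\{d_{k'}:k'\in K'\}$ of elements of a non-commutative probability space $(\mathcal{A},\varphi)$ with $\varphi$ tracial, and assume $$\sup_{1\le i\le N,\ N=1,2,\dots}|d^{k'}_{i,N}|=M(k')<\infty\quad\text{for all }k'\in K'.$$ Then, as $N\to\infty$, the family $\{Y_N^{i,k},Y_N^{j,k},D_{k',N}:i\in I,\ j\in J,\ k\in K,\ k'\in K'\}$, with respect to $\varphi_N$, converges in distribution to a family $\{s_{i,k},s_{j,k},d_{k'}:i\in I,\ j\in J,\ k\in K,\ k'\in K'\}$ of elements of a non-commutative probability space, where the sets $\{s_{i,k}:i\in I\}\cup\{s_{j,k}:j\in J\}$, $k\in K$, together with the set $\{d_{k'}:k'\in K'\}$, form a free family.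
   Context: $(\Omega,\mu)$ is a probability space, $L^{\infty-}(\Omega,\mu)=\bigcap_{p\ge1}L^p(\Omega,\mu)$ and $E(f)=\int_\Omega f\,d\mu$. $\mathrm{Tr}$ is the unnormalized trace. On $M_N(L^{\infty-}(\Omega,\mu))$ (which contains $M_N(\mathbb{C})$ as constant matrices) put $\varphi_N([f_{i,j}])=\frac1N\sum_{i=1}^N E(f_{i,i})$. A non-commutative probability space $(\mathcal{A},\varphi)$ is a unital complex algebra with a unital linear functional. Convergence in distribution of families means convergence of all joint moments, i.e. of the values of the functionals on all (non-commutative) monomials in the elements of the family. Freeness of sets means freeness of the unital subalgebras they generate. A matrix $C=(c_{k,l})$ indexed by $(I\cup J)\times(I\cup J)$ is called positive definite if it is Hermitian and $(c_{\chi(k),\chi(l)})_{k,l=1}^m\ge 0$ (positive semidefinite, possibly singular) for all $m\in\mathbb{N}$ and $\chi:\{1,\dots,m\}\to I\cup J$. *)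

(* Defs.v *)
From HB Require Import structures.
From mathcomp Require Import all_boot all_order all_algebra.
From mathcomp Require Import all_classical all_reals all_analysis.
From mathcomp Require Export complex.

Set Implicit Arguments.
Unset Strict Implicit.
Unset Printing Implicit Defensive.

Import Order.TTheory GRing.Theory Num.Theory.
Import numFieldNormedType.Exports.
Local Open Scope classical_set_scope.
Local Open Scope ring_scope.
Local Open Scope complex_scope.

(* R[i] carries its topology through its numFieldType structure. *)
Definition ccvg (R : realType) (u : nat -> R[i]) (l : R[i]) : Prop :=
  (u : nat -> (R[i] : numFieldType)) @ \oo --> (l : (R[i] : numFieldType)).

Record ncProbSpace (R : realType) := NCProbSpace {
  nc_alg :> algType R[i];
  nc_state : {scalar nc_alg};
  nc_state1 : nc_state 1 = 1 }.

Definition tracial (R : realType) (A : ncProbSpace R) : Prop :=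
  forall a b : A, nc_state A (a * b) = nc_state A (b * a).

(* The approximating spaces are only required to be rings with a map to the
   scalars, because matrices of arbitrary (possibly null) size and with entries
   in a ring of functions are pzRingType but not algType. A word w stands for
   the monomial obtained by multiplying its letters from left to right. *)
Definition cvg_in_distribution (R : realType) (V : Type)
    (M : nat -> pzRingType) (phi : forall N, M N -> R[i])
    (a : forall N, V -> M N) (A : ncProbSpace R) (b : V -> A) : Prop :=
  forall w : seq V,
    ccvg (fun N => phi N (\prod_(v <- w) a N v))
         (nc_state A (\prod_(v <- w) b v)).

Definition generated_subalgebra (R : realType) (A : algType R[i]) (S : set A) :
    set A :=
  smallest (fun B : set A => GRing.subalg_closed [pred x | x \in B]) S.

Definition free_family (R : realType) (A : ncProbSpace R) (V : Type)
    (S : V -> set A) : Prop :=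
  forall (n : nat) (v : nat -> V) (a : nat -> A),
    (0 < n)%N ->
    (forall r, (r < n)%N -> generated_subalgebra (S (v r)) (a r)) ->
    (forall r, (r < n)%N -> nc_state A (a r) = 0) ->
    (forall r, (r.+1 < n)%N -> v r <> v r.+1) ->
    nc_state A (\prod_(r < n) a r) = 0.

Definition psd_mx (R : realType) (m : nat) (A : 'M[R[i]]_m) : Prop :=
  forall z : 'cV[R[i]]_m, 0 <= ((map_mx Num.conj z)^T *m A *m z) 0 0.

Definition posdef_kernel (R : realType) (L : Type) (c : L -> L -> R[i]) : Prop :=
  (forall k l, c l k = Num.conj (c k l)) /\
  (forall (m : nat) (chi : 'I_m -> L),
     psd_mx (\matrix_(k, l) c (chi k) (chi l))).

Section ComplexRandomVariables.
Context d (T : measurableType d) (R : realType) (P : probability T R).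

(* Representatives of the elements of the intersection of the complex L^p. *)
Definition Linfm (f : T -> R[i]) : Prop :=
  [/\ measurable_fun setT (fun w => complex.Re (f w)),
      measurable_fun setT (fun w => complex.Im (f w)) &
      forall p : R, 1 <= p -> (fun w => complex.Re `|f w|) \in Lfun P p%:E].

Definition cexpect (f : T -> R[i]) : R[i] :=
  Rintegral P setT (fun w => complex.Re (f w)) +i*
  Rintegral P setT (fun w => complex.Im (f w)).

(* The Borel sets of C = R x R are generated by the preimages of Borel sets of
   R under Re and Im. *)
Definition sigma_generated (X : set (T -> R[i])) : set (set T) :=
  <<s \bigcup_(f in X)
        (preimage_set_system setT (fun w => complex.Re (f w)) measurable `|`
         preimage_set_system setT (fun w => complex.Im (f w)) measurable) >>.

Definition independent_sets (V : finType) (D : {set V})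
    (X : V -> set (T -> R[i])) : Prop :=
  forall (S : {set V}) (A : V -> set T), S \subset D ->
    (forall v, v \in S -> sigma_generated (X v) (A v)) ->
    P (\bigcap_(v in [set` S]) A v) = (\prod_(v in S) P (A v))%E.

Definition phi_mx (N : nat) (F : 'M[T -> R[i]]_N) : R[i] :=
  N%:R^-1 * \sum_(i < N) cexpect (F i i).

Definition mx_cst (N : nat) (A : 'M[R[i]]_N) : 'M[T -> R[i]]_N :=
  map_mx (fun z => cst z) A.

End ComplexRandomVariables.

Definition ntrace (R : realType) (N : nat) (A : 'M[R[i]]_N) : R[i] :=
  N%:R^-1 * \tr A.

(* Main.v *)
(** Expanding a product of traces of words in the [Y]'s and [D]'s into walks on
[{1, ..., N}], the expectation factorizes over the unordered pairs [{i, j}], and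
only walks using each pair at least twice contribute.  Comparing the number of
vertices of a walk with the number of distinct pairs it uses shows that, up to
[O(N^(-1/2))], a given letter [Y^(l,k)_(i,j)] must be matched with exactly one
other letter [Y^(l',k)_(j,i)], used in the opposite direction and in the same
cycle.  Removing the two letters cuts the cycle into two, hence by induction
products of traces have limits, which are products of the moments [m] given by
the Schwinger-Dyson equations
  [m (u ++ Y^(l,k) :: w) =
     \sum_(w = w1 ++ Y^(l',k) :: w2) c_k(l, l') m (w1) m (u ++ w2)]
for [u] a word in the [D]'s.  The limit family is realized in the free algebra;
its freeness follows by expanding an alternating product of centred words with
the equations at its first [Y] and by induction on the length. *)

Require Import Defs.
From HB Require Import structures.
From mathcomp Require Import all_boot all_order all_algebra.
From mathcomp Require Import ring lra zify.
From mathcomp.multinomials Require monalg.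

Set Implicit Arguments.
Unset Strict Implicit.
Unset Printing Implicit Defensive.

Import Order.TTheory GRing.Theory Num.Theory.
Local Open Scope ring_scope.

(** * The free algebra *)

(** Matching two letters turns one trace into a product of two, and expectations of such products do
    not factor for fixed $N$. The statement proved by induction must therefore concern products of
    traces; asymptotic factorization comes with it. No pairings are enumerated: [limit_moment] is a
    [lim], and the equations for it are obtained together with its existence. The error is
    controlled by one power count. With n letters [Y] spread over q cycles, the normalization gives
    N^(-q), the moment bound gives N^(-n/2), and the families visiting v vertices number at most a
    constant times N^v. What is left after subtracting the matched terms must thus vanish as soon as
    2v >= 2q + n; the one unit missing from 2v is the origin of N^(-1/2). Probability enters only
    through a function [e] on lists of edges: symmetric, multiplicative over lists without a common
    pair, zero on singletons, prescribed on an edge followed by its reverse, and of order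
    N^(-n/2). *)

Section FreeAlgebra.
Import -(notations) monalg.

Lemma malg_scalerAr (K : monomType) (F : comNzRingType) (c : F) (x y : malg K F) :
  c *: (x * y) = x * (c *: y).
Proof.
have ZU (d : F) (l : K) : c *: mkmalgU l d = mkmalgU l (c * d).
  by rewrite -!mul_malgC malgM_def fgmulUU mul1m.
rewrite {1 2}[y]monalgE mulr_sumr !scaler_sumr mulr_sumr; apply: eq_bigr => k _.
rewrite ZU !malgM_def !fgmulgU scaler_sumr; apply: eq_bigr => l _.
by rewrite ZU mulrCA.
Qed.

Variables (F : fieldType) (V : choiceType).

Definition free_alg : Type := malg (fmonom V) F.
HB.instance Definition _ := GRing.Lalgebra.on free_alg.

Fact free_alg_scalerAr (c : F) (x y : free_alg) : c *: (x * y) = x * (c *: y).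
Proof. exact: malg_scalerAr. Qed.

HB.instance Definition _ :=
  GRing.Lalgebra_isAlgebra.Build F free_alg free_alg_scalerAr.

Definition free_gen (v : V) : free_alg := mkmalgU (fmu v) 1.

Lemma prod_free_gen (w : seq V) :
  \prod_(v <- w) free_gen v = mkmalgU (FMonom w) 1.
Proof.
elim: w => [|v w IHw]; first by rewrite big_nil -fmE.
rewrite big_cons IHw [_ * _]malgM_def fgmulUU mulr1; congr mkmalgU.
by rewrite /mul /= /fmmul /fmu !fmE.
Qed.

Variable m : seq V -> F.

Definition free_state (x : free_alg) : F^o :=
  mmap idfun (fun w : fmonom V => m w) x.

Fact free_state_linear : linear free_state.
Proof.
move=> c x y; rewrite /free_state mmapD; congr (_ + _).
rewrite (mmapEw (msuppZ_le c x)) mmapE /= scaler_sumr.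
by apply: eq_bigr => k _; rewrite mcoeffZ /= -mulrA.
Qed.
HB.instance Definition _ :=
  GRing.isLinear.Build F free_alg F^o *:%R free_state free_state_linear.

(** Any function on words is thus realized as the joint moments of the generators; unitality of the
    state then only asks for [m [::] = 1]. *)
Lemma free_state_prod (w : seq V) : free_state (\prod_(v <- w) free_gen v) = m w.
Proof. by rewrite prod_free_gen /free_state mmapU mul1r. Qed.
End FreeAlgebra.

(** * Freeness from the Schwinger-Dyson equations *)

Section SchwingerDyson.
Variables (F : comNzRingType) (L D K : Type) (col : L -> K) (c : L -> L -> F).
Notation V := (L + D)%type.

(** Recursion on [w], with the letters already passed pushed into the first argument of [Phi], gives
    prefix and suffix as words and avoids handling positions. *)
Fixpoint splitsum (l : L) (w : seq V) (Phi : seq V -> seq V -> F) : F :=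
  if w is x :: w' then
    (if x is inl l' then c l l' * Phi [::] w' else 0) +
    splitsum l w' (fun a b => Phi (x :: a) b)
  else 0.

(** The weight is kept on both sides of the hypothesis, so the two functions may differ at partners
    with [c l l' = 0]; this is how letters of another colour are discarded. *)
Lemma eq_splitsum l w (Phi Psi : seq V -> seq V -> F) :
  (forall a l' b, w = a ++ inl l' :: b -> c l l' * Phi a b = c l l' * Psi a b) ->
  splitsum l w Phi = splitsum l w Psi.
Proof.
elim: w Phi Psi => //= x w IHw Phi Psi H; congr (_ + _).
  by case: x H => // l' /(_ [::] l' w erefl).
by apply: IHw => a l' b wE; apply: (H (x :: a)); rewrite wE.
Qed.

Lemma splitsum_cat l p t (Phi : seq V -> seq V -> F) :
  splitsum l (p ++ t) Phi =
  splitsum l p (fun a b => Phi a (b ++ t)) +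
  splitsum l t (fun a b => Phi (p ++ a) b).
Proof. by elim: p Phi => [|x p IHp] Phi /=; rewrite ?add0r // IHp addrA. Qed.

Lemma splitsumD l w (Phi Psi : seq V -> seq V -> F) :
  splitsum l w (fun a b => Phi a b + Psi a b) =
  splitsum l w Phi + splitsum l w Psi.
Proof.
elim: w Phi Psi => [|x w IHw] Phi Psi /=; first by rewrite addr0.
by rewrite IHw; case: x => [l'|d] /=; ring.
Qed.

Lemma splitsumZ l w k (Phi : seq V -> seq V -> F) :
  splitsum l w (fun a b => k * Phi a b) = k * splitsum l w Phi.
Proof.
elim: w Phi => [|x w IHw] Phi /=; first by rewrite mulr0.
by rewrite IHw; case: x => [l'|d] /=; ring.
Qed.

Lemma splitsum_sum (A : Type) (r : seq A) l w (Phi : A -> seq V -> seq V -> F) :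
  splitsum l w (fun a b => \sum_(k <- r) Phi k a b) =
  \sum_(k <- r) splitsum l w (Phi k).
Proof.
elim: r => [|k r IHr].
  rewrite big_nil (eq_splitsum (Psi := fun _ _ => 0 * 0)) => [|a l' b _].
    by rewrite splitsumZ mul0r.
  by rewrite big_nil mul0r.
rewrite big_cons -IHr -splitsumD.
by apply: eq_splitsum => a l' b _; rewrite big_cons.
Qed.

Variable m : seq V -> F.

(* [cexp ws Phi] evaluates the linear extension of [Phi] at the product of the
   centred words [w - m w], [w] in [ws]. *)
Fixpoint cexp (ws : seq (seq V)) (Phi : seq V -> F) : F :=
  if ws is w :: ws' then cexp ws' (fun t => Phi (w ++ t)) - m w * cexp ws' Phi
  else Phi [::].

Lemma eq_cexp ws (Phi Psi : seq V -> F) : Phi =1 Psi -> cexp ws Phi = cexp ws Psi.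
Proof.
elim: ws Phi Psi => [|w ws IHws] Phi Psi H /=; first exact: H.
by congr (_ - _ * _); apply: IHws => // t; apply: H.
Qed.

Lemma cexpD ws (Phi Psi : seq V -> F) :
  cexp ws (fun t => Phi t + Psi t) = cexp ws Phi + cexp ws Psi.
Proof. by elim: ws Phi Psi => //= w ws IHws Phi Psi; rewrite !IHws; ring. Qed.

Lemma cexpZ ws k (Phi : seq V -> F) :
  cexp ws (fun t => k * Phi t) = k * cexp ws Phi.
Proof. by elim: ws Phi => //= w ws IHws Phi; rewrite !IHws; ring. Qed.

Lemma cexp0 ws : cexp ws (fun=> 0) = 0.
Proof. by elim: ws => //= w ws ->; rewrite mulr0 subr0. Qed.

Lemma cexp_rcons ws w (Phi : seq V -> F) :
  cexp (rcons ws w) Phi = cexp ws (fun t => Phi (t ++ w)) - m w * cexp ws Phi.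
Proof.
elim: ws Phi => [|w' ws IHws] Phi /=; first by rewrite cats0.
rewrite !IHws; under eq_cexp => t do rewrite catA.
ring.
Qed.

Lemma cexp_splitsum ws l p (Phi : seq V -> seq V -> seq V -> F) :
  cexp ws (fun t => splitsum l p (Phi t)) =
  splitsum l p (fun a b => cexp ws (fun t => Phi t a b)).
Proof.
elim: p Phi => [|x p IHp] Phi /=; first exact: cexp0.
rewrite cexpD IHp; congr (_ + _).
by case: x {IHp} => [l'|d]; rewrite ?cexp0 // cexpZ.
Qed.

(** The partner of [l] lies in some word of [ws]. The words before that one fall entirely into the
    first factor and stay centred there, as recorded in [pre]; the first half of the cut word joins
    them uncentred. For a word [w] passed over without a cut, the term carrying [w] and the term
    with [- m w] combine into [cexp] over [rcons pre w]. *)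
Lemma cexp_cross l p pre (ws : seq (option K * seq V)) Psi :
  (forall ws1 o w1 l' w2 ws2, ws = ws1 ++ (o, w1 ++ inl l' :: w2) :: ws2 ->
     c l l' * cexp (pre ++ map snd ws1) (fun t => m (p ++ t ++ w1)) = 0) ->
  cexp (map snd ws) (fun t => splitsum l t
    (fun a b => cexp pre (fun t' => m (p ++ t' ++ a)) * Psi b)) = 0.
Proof.
elim: ws pre => [//|[ o w] ws IHws] pre H /=.
rewrite (_ : cexp _ _ = cexp (map snd ws) (fun t => splitsum l w
    (fun a b => cexp pre (fun t' => m (p ++ t' ++ a)) * Psi (b ++ t))) +
  cexp (map snd ws) (fun t => splitsum l t
    (fun a b => cexp pre (fun t' => m (p ++ t' ++ w ++ a)) * Psi b))); last first.
  by rewrite -cexpD; apply: eq_cexp => t; rewrite splitsum_cat.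
(* Cuts inside [w] itself vanish by the hypothesis with [ws1] empty; the constant [m w] offers no
   letter to cut. *)
rewrite cexp_splitsum (eq_splitsum (Psi := fun _ _ => 0 * 0)) => [|a l' b wE].
  rewrite splitsumZ mul0r add0r -mulNr -cexpZ -cexpD.
  rewrite -[RHS](IHws (rcons pre w)) => [|ws1 o' w1 l' w2 ws2 wsE].
    apply: eq_cexp => t; rewrite -splitsumZ -splitsumD.
    apply: eq_splitsum => a l' b _.
    rewrite cexp_rcons; under [X in _ = _ * ((X - _) * _)]eq_cexp => t' do rewrite -catA.
    by ring.
  by rewrite cat_rcons; apply: (H ((o, w) :: ws1) o' w1 l' w2 ws2); rewrite wsE.
have := H [::] o a l' b ws; rewrite /= cats0 wE => /(_ erefl) H0.
by rewrite cexpZ mulrA H0 !mul0r mulr0.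
Qed.

Hypothesis m1 : m [::] = 1.
Hypothesis schwinger_dyson : forall (u : seq D) l w,
  m (map inr u ++ inl l :: w) =
  splitsum l w (fun a b => m a * m (map inr u ++ b)).
Hypothesis c_col : forall l l', c l l' = 0 \/ col l = col l'.

(** By the equation at [l], the partner is either in a later word, which the second hypothesis
    discards, or in [p = a ++ inl l' :: b]. In the latter case the first hypothesis allows [b] to be
    replaced by the scalar [m b]; the sum over the partners then rebuilds [m (inl l :: p)], exactly
    the constant subtracted by centring. *)
Lemma cexp_step (u : seq D) l p ws :
  (forall a b, p = a ++ b ->
     cexp (b :: ws) (fun t => m (map inr u ++ t)) = 0) ->
  cexp ws (fun t => splitsum l t
    (fun a b => m (p ++ a) * m (map inr u ++ b))) = 0 ->
  cexp ((inl l :: p) :: ws) (fun t => m (map inr u ++ t)) = 0.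
Proof.
move=> H1 H2 /=.
under eq_cexp => t do rewrite schwinger_dyson splitsum_cat.
rewrite cexpD H2 addr0 cexp_splitsum.
rewrite (eq_splitsum (Psi := fun a b =>
  cexp ws (fun t => m (map inr u ++ t)) * (m a * m b))).
  by rewrite splitsumZ mulrC -(schwinger_dyson [::]) subrr.
move=> a l' b pE; rewrite cexpZ.
have /(H1 (rcons a (inl l'))) /=: p = rcons a (inl l') ++ b by rewrite cat_rcons.
by move/subr0_eq ->; congr (_ * _); ring.
Qed.

Definition color (x : V) : option K := if x is inl l then Some (col l) else None.

Fixpoint mono (o : option K) (w : seq V) : Prop :=
  if w is x :: w' then color x = o /\ mono o w' else True.

Lemma mono_cat o a b : mono o (a ++ b) <-> mono o a /\ mono o b.
Proof. by elim: a => [|x a IHa] /=; tauto. Qed.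

(** The colour accompanies each word as data, since an empty word has every colour and cutting a
    word may leave an empty one. *)
Fixpoint alt_words (ws : seq (option K * seq V)) : Prop :=
  if ws is (o, w) :: ws' then
    [/\ mono o w, (if ws' is (o', _) :: _ then o <> o' else True) & alt_words ws']
  else True.

Lemma alt_words_catl ws1 ws2 : alt_words (ws1 ++ ws2) -> alt_words ws1.
Proof.
elim: ws1 => [//|[ o w] ws1 IH] /= [ow oo' /IH a1]; split => //.
by case: ws1 oo' {IH a1} => [|[]].
Qed.

Lemma alt_words_catr ws1 ws2 : alt_words (ws1 ++ ws2) -> alt_words ws2.
Proof. by elim: ws1 => [//|[ o w] ws1 IH] /= [_ _ /IH]. Qed.

Lemma alt_words_subst ws1 o w w' ws2 : mono o w' ->
  alt_words (ws1 ++ (o, w) :: ws2) -> alt_words (ws1 ++ (o, w') :: ws2).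
Proof.
move=> ow'; elim: ws1 => [[_ ? ?]|[ o1 w1] ws1 IH] //= [o1w1 oo' /IH a1].
by split => //; case: ws1 oo' {IH a1} => [|[]].
Qed.

Definition wsize (ws : seq (option K * seq V)) : nat :=
  sumn (map (fun x => (size x.2).+1) ws).

Lemma wsize_cat ws1 ws2 : wsize (ws1 ++ ws2) = (wsize ws1 + wsize ws2)%N.
Proof. by rewrite /wsize map_cat sumn_cat. Qed.

(** Writing both [p] and [a] as a centred word plus a constant leaves four products of centred
    words. *)
Lemma cexp_sandwich p ws a :
  cexp ws (fun t => m (p ++ t ++ a)) =
  cexp (p :: rcons ws a) m + m p * cexp (rcons ws a) m +
  m a * cexp (p :: ws) m + m a * m p * cexp ws m.
Proof.
rewrite /= !cexp_rcons /=; set x := cexp ws _; set y := cexp ws _.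
by set z := cexp ws _; set v := cexp ws _; rewrite /x; ring.
Qed.

(** A partner inside the same word is absorbed by centring. A partner in a later word encloses,
    together with the first letter, a shorter product of the same kind, nonempty because neighbours
    differ in colour. *)
Lemma cexp_alternating ws : alt_words ws -> ws <> [::] ->
  cexp (map snd ws) m = 0.
Proof.
have [n] := ubnP (wsize ws); elim: n ws => // n IHn.
have cross l p rest (u : seq D) :
    (wsize ((Some (col l), inl l :: p) :: rest) < n.+1)%N ->
    alt_words ((Some (col l), inl l :: p) :: rest) ->
  cexp (map snd rest) (fun t => splitsum l t
    (fun a b => m (p ++ a) * m (map inr u ++ b))) = 0.
  move=> ltn aws.
  rewrite -[RHS](cexp_cross (l := l) (p := p) (pre := [::]) (ws := rest)
    (fun b => m (map inr u ++ b))) //=.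
  move=> ws1 o w1 l' w2 ws2 restE.
  have [->|cll'] := c_col l l'; first by rewrite mul0r.
  rewrite {rest}restE in ltn aws.
  have oE : o = Some (col l).
    case: (alt_words_catr (ws1 := _ :: ws1) aws) => /mono_cat[_ /= []].
    by rewrite -cll'.
  rewrite {}oE in ltn aws.
  (* The next word has a colour other than [col l], so it cannot contain the partner. Without a word
     in between, the last product of [cexp_sandwich] would involve [m [::] = 1]. *)
  have ws1N0 : ws1 <> [::] by move=> ws10; move: aws; rewrite ws10 => -[_ /=].
  pose A := (Some (col l), p); pose B := (Some (col l), w1).
  have mw1 : mono (Some (col l)) w1.
    by case: (alt_words_catr (ws1 := _ :: ws1) aws) => /mono_cat[].
  have mp : mono (Some (col l)) p by case: aws => -[].
  have aAB : alt_words (A :: rcons ws1 B).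
    apply: (alt_words_catl (ws2 := ws2)); rewrite -cats1 /= -catA /=.
    apply: (alt_words_subst (ws1 := A :: ws1) mw1).
    exact: (alt_words_subst (ws1 := [::]) mp aws).
  have ltAB : (wsize (A :: rcons ws1 B) < n)%N.
    move: ltn; rewrite -cats1 -cat1s -[_ :: _ ++ _]cat1s !wsize_cat /wsize /=.
    by rewrite size_cat /=; lia.
  rewrite cexp_sandwich.
  have sn x : map snd (A :: x) = p :: map snd x by [].
  have rn x : map snd (rcons x B) = rcons (map snd x) w1.
    by rewrite map_rcons.
  have W x y : (wsize (x ++ y) < n)%N -> (wsize x < n)%N /\ (wsize y < n)%N.
    by rewrite wsize_cat; lia.
  have aB : alt_words (rcons ws1 B) by case: aAB.
  have lB : (wsize (rcons ws1 B) < n)%N by case: (W [:: A] _ ltAB).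
  have aA : alt_words (A :: ws1).
    by apply: (alt_words_catl (ws2 := [:: B])); rewrite /= cats1.
  have lA : (wsize (A :: ws1) < n)%N.
    by case: (W (A :: ws1) [:: B]) => //; rewrite /= cats1.
  have a1 : alt_words ws1 by case: aA.
  have l1 : (wsize ws1 < n)%N by case: (W [:: A] _ lA).
  have := IHn _ ltAB aAB; rewrite sn rn => -> //.
  have := IHn _ lB aB; rewrite rn => ->; last by case: (ws1).
  have := IHn _ lA aA; rewrite sn => -> //.
  by rewrite IHn // !mulr0 !addr0 mulr0.
case=> // -[ o [|[l|d] w]] rest ltn aws _.
- by rewrite /= m1 mul1r subrr.
- have oE : o = Some (col l) by case: aws => -[].
  rewrite {}oE in ltn aws.
  apply: (cexp_step (u := [::])) => [a b wE|]; last exact: cross ltn aws.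
  apply: (IHn ((Some (col l), b) :: rest)) => //.
    by move: ltn; rewrite /wsize /= wE size_cat; lia.
  apply: (alt_words_subst (ws1 := [::]) _ aws).
  by case: aws => -[_]; rewrite wE => /mono_cat[].
(* A word in the [D]'s has no letter to expand: it becomes the prefix [u], and the equation is
   applied at the first letter of the next word. *)
- set w0 := inr d :: w in ltn aws *.
  have [u w0E] : exists u, w0 = map inr u.
    have : mono None w0 by case: aws => -[<-].
    elim: (w0) => [|[l|d'] w' IHw] /=; [by exists [::] | by case|].
    by case=> _ /IHw[u ->]; exists (d' :: u).
  case: rest ltn aws => [|[ o2 w2] rest] ltn aws.
    by rewrite /= cats0 m1 mulr1 subrr.
  have o2N : o2 <> None by case: aws => -[<- _] /= + _ => /nesym.
  have a2 : alt_words ((o2, w2) :: rest) by case: aws.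
  have l2 : (wsize ((o2, w2) :: rest) < n)%N.
    by move: ltn; rewrite /wsize /=; lia.
  suff H : cexp (map snd ((o2, w2) :: rest)) (fun t => m (w0 ++ t)) = 0.
    rewrite -[LHS]/(cexp (map snd ((o2, w2) :: rest)) (fun t => m (w0 ++ t))
      - m w0 * cexp (map snd ((o2, w2) :: rest)) m).
    by rewrite H IHn // mulr0 subr0.
  case: w2 ltn aws a2 l2 => [|[l|d'] p] ltn aws a2 l2.
  + by rewrite /= m1 mul1r subrr.
  + have oE : o2 = Some (col l) by case: a2 => -[].
    rewrite {}oE {o2N} in ltn aws a2 l2 *; rewrite {}w0E in ltn aws *.
    apply: cexp_step => [a b wE|]; last by apply: cross a2; apply: ltnW.
    have mb : mono (Some (col l)) b.
      by case: a2 => -[_]; rewrite wE => /mono_cat[].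
    set ws := map snd rest.
    have -> : cexp (b :: ws) (fun t => m (map inr u ++ t)) =
      cexp (map inr u :: b :: ws) m + m (map inr u) * cexp (b :: ws) m.
      by rewrite /=; ring.
    have E1 := IHn ((o, map inr u) :: (Some (col l), b) :: rest).
    have E2 := IHn ((Some (col l), b) :: rest).
    rewrite [cexp (_ :: b :: _) _]E1 ?[cexp (b :: _) _]E2 ?mulr0 ?addr0 //.
    * by move: l2; rewrite /wsize /= wE size_cat; lia.
    * exact: (alt_words_subst (ws1 := [::]) mb a2).
    * by move: ltn; rewrite /wsize /= wE size_cat /=; lia.
    * exact: (alt_words_subst (ws1 := [:: _]) mb aws).
  + by case: a2 => -[/esym].
Qed.
End SchwingerDyson.

(** * Walks *)

Section Walks.
Variables (L : eqType) (N : nat).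
Notation edge := (L * 'I_N * 'I_N)%type.

(** An edge [(l, a, b)] stands for the entry in row [a] and column [b] of the matrix labelled
    [l]. *)
Fixpoint walk (i : 'I_N) (t : seq edge) (j : 'I_N) : bool :=
  if t is (_, a, b) :: t' then (i == a) && walk b t' j else i == j.

Definition key (x : edge) : {set 'I_N} := [set x.1.2; x.2].
Definition vertices (t : seq edge) : {set 'I_N} := \bigcup_(x <- t) key x.
Definition keys (t : seq edge) : {set {set 'I_N}} := [set k in map key t].

Lemma walk_cat i t1 t2 j :
  walk i (t1 ++ t2) j = [exists k, walk i t1 k && walk k t2 j].
Proof.
elim: t1 i => [|[[l a] b] t1 IH] i /=.
  apply/idP/existsP => [H|[k /andP[/eqP->]]] //.
  by exists i; rewrite eqxx.
rewrite IH; case: (i == a) => //=.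
by apply/esym/existsP => -[].
Qed.

Lemma vertices_nil : vertices [::] = set0.
Proof. by rewrite /vertices big_nil. Qed.

Lemma vertices_cons x t : vertices (x :: t) = key x :|: vertices t.
Proof. by rewrite /vertices big_cons. Qed.

Lemma vertices_cat t1 t2 : vertices (t1 ++ t2) = vertices t1 :|: vertices t2.
Proof. by rewrite /vertices big_cat. Qed.

Lemma keys_nil : keys [::] = set0.
Proof. by apply/setP => k; rewrite !inE. Qed.

Lemma keys_cons x t : keys (x :: t) = key x |: keys t.
Proof. by apply/setP => k; rewrite !inE. Qed.

Lemma keys_cat t1 t2 : keys (t1 ++ t2) = keys t1 :|: keys t2.
Proof. by apply/setP => k; rewrite !inE map_cat mem_cat. Qed.

Lemma mem_keys k t : (k \in keys t) = (k \in map key t).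
Proof. by rewrite inE. Qed.

Lemma keys_sub_vertices t k : k \in keys t -> k \subset vertices t.
Proof.
elim: t => [|x t IH]; first by rewrite keys_nil inE.
rewrite keys_cons vertices_cons in_setU1 => /orP[/eqP->|/IH kt]; first exact: subsetUl.
by apply: (subset_trans kt); exact: subsetUr.
Qed.

Lemma walk_source i t j : walk i t j -> t != [::] -> i \in vertices t.
Proof.
case: t => [//|[[l a] b] t] /= /andP[/eqP-> _] _.
by rewrite vertices_cons /key !inE eqxx.
Qed.

Lemma walk_target i t j : walk i t j -> j \in i |: vertices t.
Proof.
elim: t i => [|[[l a] b] t IH] i /=; first by move/eqP->; rewrite !inE eqxx.
case/andP => /eqP-> /IH; rewrite vertices_cons /key !inE => /orP[/eqP->|->].
  by rewrite eqxx !orbT.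
by rewrite !orbT.
Qed.

Definition spanned (S : {set 'I_N}) (K : {set {set 'I_N}}) :=
  forall k, k \in K -> k \subset S.

(* The traversed edges leading to a new vertex are pairwise distinct. *)
Lemma walk_vertices (S : {set 'I_N}) (K : {set {set 'I_N}}) i t j :
  i \in S -> spanned S K -> walk i t j ->
  (#|S :|: vertices t| + #|K| <= #|S| + #|K :|: keys t|)%N.
Proof.
elim: t S K i => [|[[l a] b] t IH] S K i iS sK.
  by move=> _; rewrite vertices_nil keys_nil !setU0.
move=> /= /andP[/eqP ia wt]; rewrite -{a}ia.
rewrite vertices_cons keys_cons.
set k := key _; have kE : k = [set i; b] by [].
have SE : S :|: (k :|: vertices t) = (b |: S) :|: vertices t.
  apply/setP => z; rewrite kE !inE; case: (z =P i) => [->|_].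
    by rewrite iS !orbT.
  by rewrite /= orbCA orbA.
have KE : K :|: (k |: keys t) = (k |: K) :|: keys t by rewrite setUCA setUA.
have sK' : spanned (b |: S) (k |: K).
  move=> z; rewrite in_setU1 => /orP[/eqP->|/sK zS].
    by rewrite kE subUset !sub1set !inE iS eqxx orbT.
  by apply: (subset_trans zS); exact: subsetUr.
have := IH (b |: S) (k |: K) b _ sK' wt; rewrite SE KE !inE eqxx => /(_ isT).
have [bS|bS] := boolP (b \in S).
  have -> : b |: S = S by apply/setUidPr; rewrite sub1set.
  by apply: leq_trans; rewrite leq_add2l; apply/subset_leq_card/subsetUr.
have kK : k \notin K.
  by apply: contra bS => /sK; rewrite kE subUset !sub1set => /andP[].
by rewrite !cardsU1 kK bS addnCA -addnA leq_add2l.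
Qed.

Fixpoint closed_walks (ts : seq (seq edge)) : Prop :=
  if ts is t :: ts' then (exists i, walk i t i) /\ closed_walks ts' else True.

(* A closed walk may be started at any of its vertices, so only those sharing
   no edge with the previous ones can contribute an extra vertex. *)
Lemma closed_walks_vertices (S : {set 'I_N}) (K : {set {set 'I_N}}) ts :
  spanned S K -> closed_walks ts ->
  (#|S :|: vertices (flatten ts)| + #|K| + (K :&: keys (flatten ts) != set0) <=
   #|S| + #|K :|: keys (flatten ts)| + count (fun t => t != [::]) ts)%N.
Proof.
elim: ts S K => [|t ts IH] S K sK /=.
  by move=> _; rewrite vertices_nil keys_nil !setU0 setI0 eqxx; lia.
case=> -[i wt] cts.
have [->|t0] := eqVneq t [::]; first by rewrite add0n; exact: IH.
rewrite vertices_cat keys_cat !setUA.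
set S1 := S :|: vertices t; set K1 := K :|: keys t.
have sK1 : spanned S1 K1.
  move=> k; rewrite in_setU => /orP[/sK kS|/keys_sub_vertices kt].
    by apply: (subset_trans kS); exact: subsetUl.
  by apply: (subset_trans kt); exact: subsetUr.
have := IH _ _ sK1 cts.
have aux (v e c k1 b1 s1 k b r : nat) : (s1 + k + b <= r + k1 + b1 + 1 ->
    v + k1 + b1 <= s1 + e + c -> v + k + b <= r + e + (1 + c))%N by lia.
apply: aux.
(* If [t] has no edge in [K], it may cost an extra vertex, and the credit for a shared edge is left
   to the remaining walks; otherwise the vertex it saves pays for the credit. *)
have [Kt|Kt] := eqVneq (K :&: keys t) set0; last first.
  suff H : (#|S1| + #|K| <= #|S| + #|K1|)%N.
    by apply: leq_add (leq_b1 _); apply: (leq_trans H); exact: leq_addr.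
  case/set0Pn: Kt => k; rewrite in_setI mem_keys => /andP[/sK kS /mapP[x xt kx]].
  case/path.splitPr: xt wt @S1 @K1 sK1 {t0} => t1 t2.
  rewrite walk_cat => /existsP[a /andP[w1]].
  case: x kx => [[l b] b'] /= kx /andP[/eqP ab w2]; subst b => _.
  have aS : a \in S by move: kS; rewrite kx subUset !sub1set => /andP[].
  have w : walk a ((l, a, b') :: t2 ++ t1) a.
    by rewrite /= eqxx walk_cat; apply/existsP; exists i; rewrite w2.
  have VE : vertices ((l, a, b') :: t2 ++ t1) = vertices (t1 ++ (l, a, b') :: t2).
    by rewrite !(vertices_cat, vertices_cons) setUA setUC.
  have KE : keys ((l, a, b') :: t2 ++ t1) = keys (t1 ++ (l, a, b') :: t2).
    by rewrite !(keys_cat, keys_cons) setUA setUC.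
  by have := walk_vertices aS sK w; rewrite VE KE.
have H : (#|S1| + #|K| <= #|S|.+1 + #|K1|)%N.
  have sKi : spanned (i |: S) K.
    by move=> k /sK kS; apply: (subset_trans kS); exact: subsetUr.
  have H := walk_vertices (setU11 i S) sKi wt.
  have H1 : (#|S1| <= #|(i |: S) :|: vertices t|)%N.
    by apply/subset_leq_card/setSU/subsetUr.
  apply: leq_trans (leq_add H1 (leqnn _)) (leq_trans H _).
  by rewrite leq_add2r cardsU1 -add1n leq_add2r leq_b1.
have {}aux (a r k b b1 : nat) : (a <= r.+1 + k -> b <= b1 ->
    a + b <= r + k + b1 + 1)%N by lia.
apply: aux H _.
have : (K :&: (keys t :|: keys (flatten ts)) != set0 ->
   K1 :&: keys (flatten ts) != set0).
  rewrite setIUr Kt set0U; apply: contraNneq => H0.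
  by rewrite -subset0 -H0 setSI // subsetUl.
by case: (_ != set0) => [->|].
Qed.

End Walks.
Arguments key {L N} x.

(** * Sums over walks *)

Section PathSums.
Variables (F : numFieldType) (L : eqType) (D : Type) (N : nat) (d : D -> 'I_N -> F).
Notation edge := (L * 'I_N * 'I_N)%type.
Notation V := (L + D)%type.

(** Letters [inr] are constant: they are evaluated at the current vertex and do not move the walk.
    Only the edges of letters [inl] reach [Phi]. *)
Fixpoint psum (w : seq V) (i j : 'I_N) (Phi : seq edge -> F) : F :=
  match w with
  | [::] => (i == j)%:R * Phi [::]
  | inl l :: w' => \sum_k psum w' k j (fun t => Phi ((l, i, k) :: t))
  | inr x :: w' => d x i * psum w' i j Phi
  end.

(** The edges of all cycles are concatenated before [Phi] is applied, because the expectation of a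
    product of traces is not a product of expectations. *)
Fixpoint tsum (ws : seq (seq V)) (Phi : seq edge -> F) : F :=
  if ws is w :: ws' then
    N%:R^-1 * \sum_i psum w i i (fun t => tsum ws' (fun t' => Phi (t ++ t')))
  else Phi [::].

Definition labels (w : seq V) : seq L :=
  pmap (fun x : V => if x is inl l then Some l else None) w.
Definition label (x : edge) : L := x.1.1.

Lemma labels_cat w1 w2 : labels (w1 ++ w2) = labels w1 ++ labels w2.
Proof. exact: pmap_cat. Qed.

Lemma labels_inr (u : seq D) : labels (map inr u) = [::].
Proof. by elim: u. Qed.

Lemma eq_psum w i j (Phi Psi : seq edge -> F) :
  (forall t, walk i t j -> map label t = labels w -> Phi t = Psi t) ->
  psum w i j Phi = psum w i j Psi.
Proof.
elim: w i Phi Psi => [|[l|x] w IHw] i Phi Psi H /=.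
- by have [ij|] := eqVneq i j; [rewrite (H [::]) //= ij | rewrite !mul0r].
- apply: eq_bigr => k _; apply: IHw => t wt tw.
  by apply: H; rewrite /= ?eqxx ?tw.
- by congr (_ * _); apply: IHw.
Qed.

Lemma psum_sum (A : Type) (r : seq A) w i j (Phi : A -> seq edge -> F) :
  psum w i j (fun t => \sum_(a <- r) Phi a t) = \sum_(a <- r) psum w i j (Phi a).
Proof.
elim: w i Phi => [|[l|x] w IHw] i Phi /=; first by rewrite mulr_sumr.
  by rewrite exchange_big /=; apply: eq_bigr => k _; rewrite IHw.
by rewrite IHw mulr_sumr.
Qed.

Lemma psumZ k w i j (Phi : seq edge -> F) :
  psum w i j (fun t => k * Phi t) = k * psum w i j Phi.
Proof.
elim: w i Phi => [|[l|x] w IHw] i Phi /=; first by rewrite mulrCA.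
  by rewrite mulr_sumr; apply: eq_bigr => a _; rewrite IHw.
by rewrite IHw mulrCA.
Qed.

Lemma psumD w i j (Phi Psi : seq edge -> F) :
  psum w i j (fun t => Phi t + Psi t) = psum w i j Phi + psum w i j Psi.
Proof.
elim: w i Phi Psi => [|[l|x] w IHw] i Phi Psi /=; first by rewrite mulrDr.
  by rewrite -big_split; apply: eq_bigr => a _; rewrite IHw.
by rewrite IHw mulrDr.
Qed.

Lemma psum0 w i j : psum w i j (fun=> 0) = 0.
Proof. by have := psumZ 0 w i j (fun=> 0); rewrite mul0r mul0r. Qed.

Lemma psum_inr (u : seq D) w i j (Phi : seq edge -> F) :
  psum (map inr u ++ w) i j Phi = (\prod_(x <- u) d x i) * psum w i j Phi.
Proof.
elim: u => [|x u IHu] /=; first by rewrite big_nil mul1r.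
by rewrite IHu big_cons mulrA.
Qed.

(* Monomials indexed by a family of closed walks, one for each word in [ws]. *)
Definition cyclic (ws : seq (seq V)) (t : seq edge) : Prop :=
  exists ts, [/\ t = flatten ts, closed_walks ts &
    map (map label) ts = map labels ws].

Lemma cyclic_cons w ws i t t' : walk i t i -> map label t = labels w ->
  cyclic ws t' -> cyclic (w :: ws) (t ++ t').
Proof.
move=> wt tw [ts [-> cts tsw]]; exists (t :: ts); split => //=.
  by split => //; exists i.
by rewrite tw tsw.
Qed.

Lemma eq_tsum ws (Phi Psi : seq edge -> F) :
  (forall t, cyclic ws t -> Phi t = Psi t) -> tsum ws Phi = tsum ws Psi.
Proof.
elim: ws Phi Psi => [|w ws IHws] Phi Psi H /=; first by apply: H; exists [::].
congr (_ * _); apply: eq_bigr => i _; apply: eq_psum => t wt tw.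
by apply: IHws => t' ct'; apply: H; apply: cyclic_cons wt tw ct'.
Qed.

Lemma tsum_sum (A : Type) (r : seq A) ws (Phi : A -> seq edge -> F) :
  tsum ws (fun t => \sum_(a <- r) Phi a t) = \sum_(a <- r) tsum ws (Phi a).
Proof.
elim: ws Phi => [//|w ws IHws] Phi /=.
rewrite -mulr_sumr; congr (_ * _); rewrite [RHS]exchange_big.
apply: eq_bigr => i _ /=.
by rewrite -psum_sum; apply: eq_psum => t _ _; rewrite IHws.
Qed.

Lemma tsumZ k ws (Phi : seq edge -> F) :
  tsum ws (fun t => k * Phi t) = k * tsum ws Phi.
Proof.
elim: ws Phi => [//|w ws IHws] Phi /=.
rewrite mulrCA; congr (_ * _); rewrite mulr_sumr; apply: eq_bigr => i _.
by rewrite -psumZ; apply: eq_psum => t _ _; rewrite IHws.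
Qed.

Lemma tsumD ws (Phi Psi : seq edge -> F) :
  tsum ws (fun t => Phi t + Psi t) = tsum ws Phi + tsum ws Psi.
Proof.
elim: ws Phi Psi => [//|w ws IHws] Phi Psi /=.
rewrite -mulrDr -big_split; congr (_ * _); apply: eq_bigr => i _.
by rewrite /= -psumD; apply: eq_psum => t _ _; rewrite IHws.
Qed.

Lemma tsum0 ws : tsum ws (fun=> 0) = 0.
Proof. by have := tsumZ 0 ws (fun=> 0); rewrite mul0r mul0r. Qed.

Lemma tsum_inr (u : seq D) ws (Phi : seq edge -> F) :
  tsum (map inr u :: ws) Phi =
  N%:R^-1 * (\sum_i \prod_(x <- u) d x i) * tsum ws Phi.
Proof.
rewrite /= -mulrA mulr_suml; congr (_ * _); apply: eq_bigr => i _.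
by rewrite -{1}[map inr u]cats0 psum_inr /= eqxx mul1r.
Qed.

Section Split.
Variable c : L -> L -> F.

(** The counterpart of [splitsum] on an actual list of edges: only a reverse [(l', j, i)] of the
    removed edge is accepted as a partner. *)
Fixpoint esplit (l : L) (i j : 'I_N) (t : seq edge)
    (Psi : seq edge -> seq edge -> F) : F :=
  if t is x :: t' then
    (if (x.1.2 == j) && (x.2 == i) then c l (label x) * Psi [::] t' else 0) +
    esplit l i j t' (fun t1 t2 => Psi (x :: t1) t2)
  else 0.

Lemma eq_esplit l i j t (Phi Psi : seq edge -> seq edge -> F) :
  (forall t1 l' t2, t = t1 ++ (l', j, i) :: t2 -> Phi t1 t2 = Psi t1 t2) ->
  esplit l i j t Phi = esplit l i j t Psi.
Proof.
elim: t Phi Psi => [//|[[l' a] b] t IHt] Phi Psi H /=; congr (_ + _).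
  by case: eqP => //= aj; case: eqP => //= bi; rewrite (H [::] l') ?aj ?bi.
by apply: IHt => t1 l1 t2 tE; apply: (H (_ :: t1) l1); rewrite tE.
Qed.

Lemma esplit_notin l i j t (Psi : seq edge -> seq edge -> F) :
  [set i; j] \notin keys t -> esplit l i j t Psi = 0.
Proof.
elim: t Psi => [//|[[l' a] b] t IHt] Psi /=.
rewrite keys_cons in_setU1 negb_or => /andP[ab /IHt->]; rewrite addr0.
case: eqP => //= aj; case: eqP => //= bi; case/eqP: ab.
by rewrite /key /= aj bi setUC.
Qed.

Lemma esplit0 l i j t : esplit l i j t (fun _ _ => 0) = 0.
Proof. by elim: t => //= x t ->; rewrite mulr0 if_same addr0. Qed.

Lemma esplit_unique l i j t1 l' t2 (Psi : seq edge -> seq edge -> F) :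
  [set i; j] \notin keys t1 -> [set i; j] \notin keys t2 ->
  esplit l i j (t1 ++ (l', j, i) :: t2) Psi = c l l' * Psi t1 t2.
Proof.
move=> + kt2; elim: t1 Psi => [|[[l1 a] b] t1 IHt1] Psi /=.
  by rewrite !eqxx /= esplit_notin // addr0.
rewrite keys_cons in_setU1 negb_or => /andP[ab /IHt1->].
case: eqP => /= [aj|_]; last by rewrite add0r.
case: eqP => /= [bi|_]; last by rewrite add0r.
by case/eqP: ab; rewrite /key /= aj bi setUC.
Qed.

Lemma tsum_esplit l i j t ws (Psi : seq edge -> seq edge -> seq edge -> F) :
  esplit l i j t (fun t1 t2 => tsum ws (Psi t1 t2)) =
  tsum ws (fun t' => esplit l i j t (fun t1 t2 => Psi t1 t2 t')).
Proof.
elim: t Psi => [|x t IHt] Psi /=.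
  by rewrite tsum0.
rewrite tsumD IHt; congr (_ + _); case: ifP => _; first by rewrite tsumZ.
by rewrite tsum0.
Qed.

(** Forcing an edge to be [(l', j, i)] makes the walk arrive at [j] before it and leave from [i]
    after it. For [a = j] and [b = i] both pieces are closed: this is where one cycle becomes
    two. *)
Lemma psum_esplit l i j w a b (Psi : seq edge -> seq edge -> F) :
  psum w a b (fun t => esplit l i j t Psi) =
  splitsum c l w (fun w1 w2 =>
    psum w1 a j (fun t1 => psum w2 i b (fun t2 => Psi t1 t2))).
Proof.
elim: w a Psi => [|[l'|x] w IHw] a Psi /=; first by rewrite mulr0.
  rewrite splitsum_sum; under eq_bigr => k _ do rewrite psumD IHw.
  rewrite big_split /=; congr (_ + _).
  rewrite (bigD1 i) //= eqxx andbT big1 => [|k ki]; last first.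
    by rewrite (negbTE ki) andbF psum0.
  rewrite addr0; case: eqP => _; first by rewrite psumZ mul1r.
  by rewrite psum0 mul0r mulr0.
by rewrite IHw add0r -splitsumZ.
Qed.
End Split.
End PathSums.
Arguments label {L N} x.

(** * Size of sums over walks in terms of the number of vertices visited *)

Section Counting.
Variables (F : numFieldType) (L : eqType) (D : Type) (N : nat) (d : D -> 'I_N -> F).
Notation edge := (L * 'I_N * 'I_N)%type.
Notation V := (L + D)%type.
Variable Md : D -> F.
Hypothesis Md_ge0 : forall x, 0 <= Md x.
Hypothesis d_le : forall x i, `|d x i| <= Md x.

(* Up to a constant, the number of families of walks that extend [S] and visit
   at most [m] vertices. *)
Definition extensions (m : nat) (S : {set 'I_N}) : F :=
  if (#|S| <= m)%N then N%:R ^+ (m - #|S|) else 0.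

Lemma extensions_ge0 m S : 0 <= extensions m S.
Proof. by rewrite /extensions; case: ifP => // _; rewrite exprn_ge0. Qed.

(** A vertex [k] of [S] changes nothing, and there are at most [m] of them when the term is nonzero;
    a new one is chosen in at most $N$ ways and lowers the exponent by one. *)
Lemma sum_extensions m S :
  \sum_k extensions m (k |: S) <= m.+1%:R * extensions m S.
Proof.
rewrite (bigID (mem S)) /=.
have -> : \sum_(k in S) extensions m (k |: S) = #|S|%:R * extensions m S.
  rewrite -sum1_card natr_sum mulr_suml; apply: eq_bigr => k kS.
  by rewrite mul1r; congr extensions; apply/setUidPr; rewrite sub1set.
have -> : \sum_(k | k \notin S) extensions m (k |: S) =
    \sum_(k | k \notin S) if (#|S| < m)%N then N%:R ^+ (m - #|S|.+1) else 0.
  by apply: eq_bigr => k kS; rewrite /extensions cardsU1 kS.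
rewrite sumr_const; have [Sm|mS] := ltnP #|S| m; last first.
  rewrite mul0rn addr0 /extensions; case: ifP => Sm; last by rewrite !mulr0.
  by rewrite ler_wpM2r ?exprn_ge0 // ler_nat (leq_trans Sm).
rewrite /extensions (ltnW Sm) -[m.+1%:R]natr1 mulrDl mul1r; apply: lerD.
  by rewrite ler_wpM2r ?exprn_ge0 // ler_nat ltnW.
have -> : (m - #|S| = (m - #|S|.+1).+1)%N by rewrite subnSK.
rewrite exprS -[_ *+ #|_|]mulr_natl ler_wpM2r ?exprn_ge0 // ler_nat -[leqRHS]card_ord.
exact: max_card.
Qed.

(** Each [Y] costs the factor [m.+1] of [sum_extensions], each [D] its uniform bound. *)
Definition word_bound (m : nat) (w : seq V) : F :=
  \prod_(v <- w) if v is inr x then Md x else m.+1%:R.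

Lemma word_bound_ge0 m w : 0 <= word_bound m w.
Proof. by apply: prodr_ge0 => -[l|x] _. Qed.

Lemma psum_bound m w i j (Phi : seq edge -> F) (S : {set 'I_N}) C :
  0 <= C -> i \in S ->
  (forall t, walk i t j -> map label t = labels w ->
    `|Phi t| <= C * extensions m (S :|: vertices t)) ->
  `|psum d w i j Phi| <= word_bound m w * (C * extensions m S).
Proof.
move=> C0; elim: w i S Phi => [|[l|x] w IHw] i S Phi iS H /=.
- rewrite /word_bound big_nil mul1r; have [ij|_] := eqVneq i j; last first.
    by rewrite mul0r normr0 mulr_ge0 ?extensions_ge0.
  by have := H [::]; rewrite mul1r vertices_nil setU0 /= ij eqxx; apply.
- apply: le_trans (ler_norm_sum _ _ _) _.
  apply: (@le_trans _ _ (\sum_k word_bound m w * (C * extensions m (k |: S)))).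
    apply: ler_sum => k _; apply: IHw => [|t wt tw]; first exact: setU11.
    have := H ((l, i, k) :: t); rewrite /= eqxx wt tw => /(_ isT erefl).
    rewrite vertices_cons /key /= [S :|: _](_ : _ = k |: S :|: vertices t) //.
    apply/setP => z; rewrite !inE; case: (z =P i) => [->|_]; first by rewrite iS !orbT.
    by rewrite /= orbCA orbA.
  rewrite -!mulr_sumr [word_bound _ (_ :: _)]big_cons -/(word_bound m w).
  rewrite [leRHS](_ : _ = word_bound m w * (C * (m.+1%:R * extensions m S))); last by ring.
  by rewrite !ler_wpM2l ?word_bound_ge0 ?sum_extensions.
- rewrite normrM [word_bound _ (_ :: _)]big_cons -/(word_bound m w) -mulrA.
  by apply: ler_pM => //; apply: IHw.
Qed.

Lemma psum_bound_inr m w i j (Phi : seq edge -> F) :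
  labels w = [::] -> `|psum d w i j Phi| <= word_bound m w * `|Phi [::]|.
Proof.
elim: w i => [|[l|x] w IHw] i //= => [_|lw].
  by rewrite /word_bound big_nil mul1r; case: eqP; rewrite ?mul1r ?mul0r ?normr0.
rewrite normrM [word_bound _ (_ :: _)]big_cons -/(word_bound m w) -mulrA.
by apply: ler_pM => //; apply: IHw.
Qed.

Definition words_bound (m : nat) (ws : seq (seq V)) : F :=
  \prod_(w <- ws) (word_bound m w * m.+1%:R).

Lemma words_bound_ge0 m ws : 0 <= words_bound m ws.
Proof. by apply: prodr_ge0 => w _; rewrite mulr_ge0 ?word_bound_ge0. Qed.

(** A word without letters [inl] produces no edge, so its sum over the starting point merely
    compensates its factor $1/N$; only the other words keep theirs. *)
Definition nlabelled (ws : seq (seq V)) : nat := count (fun w => labels w != [::]) ws.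

Hypothesis N_gt0 : (0 < N)%N.

Lemma tsum_bound m ws (Phi : seq edge -> F) (S : {set 'I_N}) C :
  0 <= C ->
  (forall t, cyclic ws t -> `|Phi t| <= C * extensions m (S :|: vertices t)) ->
  `|tsum d ws Phi| <=
    words_bound m ws * (N%:R ^- nlabelled ws * (C * extensions m S)).
Proof.
move=> C0; elim: ws S Phi => [|w ws IHws] S Phi H /=.
  rewrite /words_bound big_nil expr0 invr1 !mul1r.
  by have := H [::]; rewrite vertices_nil setU0; apply; exists [::].
rewrite normrM ger0_norm ?invr_ge0 //.
have IH i t : walk i t i -> map label t = labels w ->
    `|tsum d ws (fun t' => Phi (t ++ t'))| <=
    words_bound m ws * (N%:R ^- nlabelled ws * (C * extensions m (S :|: vertices t))).
  move=> wt tw; apply: IHws => t' ct'; rewrite -setUA -vertices_cat.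
  by apply: H; apply: cyclic_cons wt tw ct'.
pose K := words_bound m ws * N%:R ^- nlabelled ws.
have K0 : 0 <= K by rewrite mulr_ge0 ?words_bound_ge0 // invr_ge0 exprn_ge0.
have IH' i t : walk i t i -> map label t = labels w ->
    `|tsum d ws (fun t' => Phi (t ++ t'))| <= K * C * extensions m (S :|: vertices t).
  by move=> wt tw; rewrite /K -!mulrA; apply: IH wt tw.
have KE : words_bound m (w :: ws) =
    word_bound m w * m.+1%:R * words_bound m ws by rewrite /words_bound big_cons.
rewrite KE; have [lw|lw] := eqVneq (labels w) [::].
  have B i : `|psum d w i i (fun t => tsum d ws (fun t' => Phi (t ++ t')))| <=
      word_bound m w * (K * C * extensions m S).
    apply: le_trans (psum_bound_inr m _ _ _ lw) _.
    rewrite ler_wpM2l ?word_bound_ge0 //.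
    by have := IH' i [::]; rewrite /= eqxx vertices_nil setU0 lw; apply.
  have B0 : 0 <= word_bound m w * (K * C * extensions m S).
    by rewrite mulr_ge0 ?word_bound_ge0 // mulr_ge0 ?extensions_ge0 // mulr_ge0.
  apply: (@le_trans _ _ (word_bound m w * (K * C * extensions m S))).
    rewrite ler_pdivrMl ?ltr0n //; apply: le_trans (ler_norm_sum _ _ _) _.
    apply: le_trans (ler_sum _ (fun i _ => B i)) _.
    by rewrite sumr_const card_ord mulr_natl.
  rewrite add0n /K.
  rewrite [leRHS](_ : _ = m.+1%:R * (word_bound m w * (words_bound m ws *
    N%:R ^- nlabelled ws * C * extensions m S))); last by ring.
  by rewrite ler_peMl ?ler1n.
(* A nonempty closed walk visits its starting point, which can be added to [S] without changing the
   set of vertices. *)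
have B i : `|psum d w i i (fun t => tsum d ws (fun t' => Phi (t ++ t')))| <=
    word_bound m w * (K * C * extensions m (i |: S)).
  have KC0 : 0 <= K * C by apply: mulr_ge0.
  apply: psum_bound KC0 (setU11 _ _) _ => t wt tw.
  rewrite (_ : i |: S :|: vertices t = S :|: vertices t); first exact: IH' wt tw.
  rewrite -setUA; apply/setUidPr; rewrite sub1set in_setU (walk_source wt) ?orbT //.
  by apply: contraNneq lw => t0; rewrite -tw t0.
rewrite ler_pdivrMl ?ltr0n //; apply: le_trans (ler_norm_sum _ _ _) _.
apply: le_trans (ler_sum _ (fun i _ => B i)) _.
rewrite -!mulr_sumr add1n exprS.
rewrite [leRHS](_ : _ = word_bound m w * (K * C * (m.+1%:R * extensions m S))).
  have KC0 : 0 <= K * C by apply: mulr_ge0.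
  by rewrite ler_wpM2l ?word_bound_ge0 // ler_wpM2l // sum_extensions.
have N0 : N%:R != 0 :> F by rewrite pnatr_eq0 -lt0n.
by rewrite /K invfM; field; rewrite expf_neq0 N0.
Qed.

End Counting.

Lemma sum_count_mem (T : finType) (s : seq T) : (\sum_x count_mem x s = size s)%N.
Proof.
elim: s => [|y s IHs] /=; first by rewrite big1.
by rewrite big_split /= IHs (bigD1 y) //= eqxx big1 // => x /negbTE; rewrite eq_sym => ->.
Qed.

Lemma perm_insert (T : eqType) (x : T) (s1 s2 : seq T) :
  perm_eq (s1 ++ x :: s2) (x :: s1 ++ s2).
Proof. by rewrite -cat1s perm_catCA. Qed.

Lemma set2_inj (T : finType) (a b i j : T) :
  [set a; b] = [set i; j] -> (a, b) = (j, i) \/ (a, b) = (i, j).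
Proof.
move=> ab; have := set21 a b; have := set22 a b; rewrite ab !inE.
case/orP => /eqP bE; case/orP => /eqP aE; subst a b; auto; left.
  by have := set22 i j; rewrite -ab !inE orbb => /eqP->.
by have := set21 i j; rewrite -ab !inE orbb => /eqP->.
Qed.

(** * Walks on which the matched terms do not give the whole moment *)

Section PairingError.
Variables (F : numFieldType) (L : eqType) (N : nat) (c : L -> L -> F).
Notation edge := (L * 'I_N * 'I_N)%type.
Notation mult k t := (count_mem k (map key t)).

Lemma mult_cat (k : {set 'I_N}) (t1 t2 : seq edge) :
  mult k (t1 ++ t2) = (mult k t1 + mult k t2)%N.
Proof. by rewrite map_cat count_cat. Qed.

Lemma mult_keys (k : {set 'I_N}) (t : seq edge) : (0 < mult k t)%N = (k \in keys t).
Proof. by rewrite inE -has_count has_pred1. Qed.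

Lemma mult1_split (k : {set 'I_N}) (t : seq edge) : mult k t = 1 ->
  exists t1 x t2, [/\ t = t1 ++ x :: t2, key x = k, k \notin keys t1 & k \notin keys t2].
Proof.
move=> k1; have : k \in map key t by rewrite -has_pred1 has_count k1.
case/mapP => x xt kx; case/path.splitPr: xt k1 => t1 t2.
rewrite mult_cat /= -kx eqxx add1n addnS => -[] /eqP; rewrite addn_eq0 => /andP[k1 k2].
by exists t1, x, t2; rewrite -!mult_keys (eqP k1) (eqP k2).
Qed.

Lemma keys_mult_ge2 (k0 : {set 'I_N}) (t : seq edge) :
  (forall k, k \in keys t -> k != k0 -> (2 <= mult k t)%N) ->
  (2 * #|keys t :\ k0| + mult k0 t <= size t)%N.
Proof.
move=> H; rewrite -[leqRHS](size_map key) -sum_count_mem (bigD1 k0) //= addnC.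
rewrite leq_add2l mulnC -sum_nat_const.
rewrite [leqRHS](bigID (mem (keys t))) /= -[leqLHS]addn0 leq_add //.
rewrite [leqLHS](eq_bigl (fun k => (k != k0) && (k \in keys t))) => [|k].
  by apply: leq_sum => k /andP[kk0 kt]; apply: H.
by rewrite !inE.
Qed.

Variable e : seq edge -> F.
Hypothesis e_perm : forall t1 t2, perm_eq t1 t2 -> e t1 = e t2.
Hypothesis e_cat : forall t1 t2, [disjoint keys t1 & keys t2] ->
  e (t1 ++ t2) = e t1 * e t2.
Hypothesis e_seq1 : forall x, e [:: x] = 0.
Hypothesis e_pair : forall l l' i j,
  e [:: (l, i, j); (l', j, i)] = N%:R^-1 * c l l'.

(** Independence isolates the only edge on this pair, and that edge is centred. *)
Lemma e_single (k : {set 'I_N}) (t : seq edge) : mult k t = 1 -> e t = 0.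
Proof.
case/mult1_split => t1 [x [t2 [-> kx k1 k2]]].
rewrite (e_perm (perm_insert _ _ _)) -cat1s.
rewrite e_cat ?e_seq1 ?mul0r // keys_cons keys_nil setU0 disjoints1 kx.
by rewrite keys_cat in_setU negb_or k1.
Qed.

Definition pairing_error l i j (t t' : seq edge) : F :=
  e ((l, i, j) :: t ++ t') -
  N%:R^-1 * esplit c l i j t (fun t1 t2 => e (t1 ++ t2 ++ t')).

(** Pairs other than [k0] occur at least twice, and connectedness bounds the vertices by the
    distinct pairs. Strictness comes from [k0]: it occurs at least three times, or joins the first
    cycle to another, or is traversed twice in the same direction. In the remaining cases the error
    is zero. *)
Lemma pairing_error_vertices l i j (t : seq edge) (ts : seq (seq edge)) :
  walk j t i -> closed_walks ts -> pairing_error l i j t (flatten ts) != 0 ->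
  (2 * #|vertices ((l, i, j) :: t ++ flatten ts)| <
   2 * (count (fun t => t != [::]) ts).+1 + (size t + size (flatten ts)).+1)%N.
Proof.
move=> wt cts; set t' := flatten ts; set x := (l, i, j); set k0 := [set i; j].
have kx : key x = k0 by [].
set q := count _ ts => err0.
have ge2 k : k \in keys (t ++ t') -> k != k0 -> (2 <= mult k (t ++ t'))%N.
  rewrite -mult_keys => k_gt0 kk0; rewrite ltn_neqAle k_gt0 andbT eq_sym.
  apply: contraNneq err0 => k1; rewrite /pairing_error (@e_single k); last first.
    by rewrite /= [_ == k](_ : _ = false) // eq_sym; apply: negbTE.
  suff -> : esplit c l i j t (fun t1 t2 => e (t1 ++ t2 ++ t')) = 0.
    by rewrite mulr0 subr0.
  rewrite -[RHS](esplit0 c l i j t); apply: eq_esplit => t1 l' t2 tE; apply: (@e_single k); move: k1.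
  rewrite tE -catA !mult_cat /=.
  by rewrite [_ == k](_ : _ = false) // /key /= setUC eq_sym; apply: negbTE.
have := keys_mult_ge2 ge2; rewrite size_cat mult_cat.
set E := #|_ :\ _| => szE.
have kE : #|keys (x :: t ++ t')| = E.+1.
  have -> : keys (x :: t ++ t') = k0 |: (keys (t ++ t') :\ k0).
    by rewrite keys_cons kx; apply/setP => z; rewrite !in_setU1 in_setD1; case: eqP.
  by rewrite cardsU1 setD11.
(* Each nonempty cycle costs at most one vertex beyond the number of keys, and one is saved if [k0]
   recurs in another cycle. *)
have gen : (#|vertices (x :: t ++ t')| + (k0 \in keys t') <= q.+1 + E.+1)%N.
  have w : walk i (x :: t) i by rewrite /= eqxx.
  have sK0 : spanned [set i] (set0 : {set {set 'I_N}}) by move=> k; rewrite inE.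
  have := walk_vertices (set11 i) sK0 w.
  rewrite (setUidPr _); last by rewrite sub1set vertices_cons /key !inE eqxx.
  rewrite set0U cards0 addn0 cards1 => H1.
  have sK : spanned (vertices (x :: t)) (keys (x :: t)).
    by move=> k; apply: keys_sub_vertices.
  have := closed_walks_vertices sK cts.
  rewrite -vertices_cat -keys_cat -/t' -/q -!cat_cons kE => H2.
  have H3 : (k0 \in keys t') ==> (keys (x :: t) :&: keys t' != set0).
    apply/implyP => k0t'; apply/set0Pn; exists k0.
    by rewrite in_setI k0t' keys_cons kx setU11.
  have aux (v1 k1 v b1 b2 f : nat) : (v1 <= 1 + k1 -> v + k1 + b1 <= v1 + f + q ->
    b2 <= b1 -> v + b2 <= q.+1 + f)%N by lia.
  by apply: aux H1 H2 _; move: H3; case: (_ \in _) => //= ->.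
(* [k0] occurs three times in all, which leaves one letter to spare. *)
have [m2|] := leqP 2 (mult k0 t + mult k0 t').
  have aux (v b m : nat) : (2 <= m -> v + b <= q.+1 + E.+1 ->
    2 * E + m <= size t + size t' -> 2 * v < 2 * q.+1 + (size t + size t').+1)%N.
    by lia.
  exact: aux m2 gen szE.
case m': (mult k0 t') => [|[|n]]; last by rewrite !addnS.
  rewrite addn0; case m1: (mult k0 t) => [|[|//]] _.
    have k0r : k0 \notin keys (t ++ t').
      by rewrite -mult_keys mult_cat m1 m'.
    case/negP: err0; rewrite /pairing_error -cat1s e_cat; last first.
      by rewrite keys_cons keys_nil setU0 disjoints1.
    rewrite e_seq1 mul0r esplit_notin ?mulr0 ?subr0 //.
    by move: k0r; rewrite keys_cat in_setU negb_or => /andP[].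
  have k0t' : k0 \notin keys t' by rewrite -mult_keys m'.
  case/mult1_split: m1 => t1 [[[l' a] b] [t2 [tE /= kab k1 k2]]].
  case: (set2_inj kab) => -[aE bE]; subst a b.
    (* The only other use of [k0] is the reverse edge: independence splits off the pair, and the two
       terms of the error are equal. *)
    case/negP: err0; rewrite /pairing_error tE esplit_unique // -catA.
    rewrite (@e_perm _ ([:: x; (l', j, i)] ++ (t1 ++ t2 ++ t'))); last first.
      by rewrite perm_cons perm_insert.
    rewrite e_cat; last first.
      rewrite !keys_cons keys_nil setU0 kx kab setUid disjoints1.
      by rewrite !keys_cat !in_setU !negb_or k1 k2.
    by rewrite e_pair mulrA subrr.
  (* Same direction: [t1] and [t2] both lead from [j] to [i], so all vertices are reached without
     [k0], and one key fewer bounds their number. *)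
  have [w1 w2] : walk j t1 i /\ walk j t2 i.
    move: wt; rewrite tE walk_cat => /existsP[a /andP[w1 /= /andP[/eqP ai w2]]].
    by rewrite ai in w1.
  have sK0 : spanned [set j] (set0 : {set {set 'I_N}}) by move=> k; rewrite inE.
  have H1 := walk_vertices (set11 j) sK0 w1.
  have sK1 : spanned (j |: vertices t1) (keys t1).
    by move=> k /keys_sub_vertices kt; apply: (subset_trans kt); exact: subsetUr.
  have H2 := walk_vertices (setU11 _ _) sK1 w2.
  have sK2 : spanned (j |: vertices t1 :|: vertices t2) (keys t1 :|: keys t2).
    move=> k; rewrite in_setU => /orP[/sK1 kt|/keys_sub_vertices kt].
      by apply: (subset_trans kt); exact: subsetUl.
    by apply: (subset_trans kt); exact: subsetUr.
  have H3 := closed_walks_vertices sK2 cts.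
  rewrite -/t' -/q in H3.
  have VE : (#|vertices (x :: t ++ t')| <=
      #|j |: vertices t1 :|: vertices t2 :|: vertices t'|)%N.
    apply/subset_leq_card/subsetP => z; rewrite tE vertices_cons !vertices_cat.
    rewrite vertices_cons !in_setU in_set1 /key /= !inE.
    have := walk_target w1; rewrite in_setU1 => it1.
    have itz : (z == i) -> (z == j) || (z \in vertices t1) by move/eqP->.
    case: (z == i) itz => /=; first by move=> /(_ isT) /orP[->|->]; rewrite ?orbT.
    by move=> _; rewrite !orbA; case: (z == j) => //=; case: (z \in vertices t1).
  have KE : (#|keys t1 :|: keys t2 :|: keys t'| <= E)%N.
    apply/subset_leq_card/subsetP => k; rewrite tE in_setD1 !keys_cat keys_cons.
    rewrite !in_setU; have [->|_] := eqVneq k k0.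
      by rewrite (negbTE k1) (negbTE k2) (negbTE k0t').
    by case: (k \in keys t1) => //=; case: (k \in keys t2) => /=; rewrite ?orbT // => ->; rewrite orbT.
  rewrite cards0 addn0 set0U cards1 in H1.
  have aux (v v1 v2 v3 k1' k2' k3 b f st : nat) : (v <= v3 -> k3 <= f ->
     v1 <= 1 + k1' -> v2 + k1' <= v1 + k2' -> v3 + k2' + b <= v2 + k3 + q ->
     2 * f + 1 <= st -> 2 * v < 2 * q.+1 + st.+1)%N by lia.
  by apply: aux VE KE H1 H2 H3 _; move: szE; rewrite m' addn0 tE mult_cat /= kab eqxx; lia.
rewrite addn1 => m0; have k0t' : k0 \in keys t' by rewrite -mult_keys m'.
rewrite k0t' in gen.
have aux (v m : nat) : (v + 1 <= q.+1 + E.+1 ->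
    2 * E + (m + 1) <= size t + size t' -> 2 * v < 2 * q.+1 + (size t + size t').+1)%N.
  by lia.
by move: szE; rewrite m'; exact: aux gen.
Qed.
End PairingError.

From mathcomp Require Import all_classical all_reals all_analysis.
From mathcomp Require Import measurable_realfun.

Import Order.TTheory GRing.Theory Num.Theory.
Import numFieldNormedType.Exports.

(** * Limits of the trace moments *)

Section SchwingerDysonFixed.
Variables (F : numFieldType) (L : eqType) (D : Type) (c : L -> L -> F).
Variables (N : nat) (d : D -> 'I_N -> F).
Notation edge := (L * 'I_N * 'I_N)%type.
Notation V := (L + D)%type.
Variable e : seq edge -> F.

(** [tsum] hands over only the concatenated edges; [k], the number of edges of the first cycle after
    [x], tells where that cycle ends. *)
Definition word_error (k : nat) (t : seq edge) : F :=
  if t is x :: r then pairing_error c e x.1.1 x.1.2 x.2 (take k r) (drop k r)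
  else 0.

(** An identity for fixed $N$, without estimates: the factor $1/N$ of the covariance serves as the
    normalization of the trace created by the cut. *)
Lemma schwinger_dyson_error (u : seq D) l w ws :
  tsum d ((map inr u ++ inl l :: w) :: ws) e -
  splitsum c l w (fun w1 w2 => tsum d (w1 :: (map inr u ++ w2) :: ws) e) =
  tsum d ((map inr u ++ inl l :: w) :: ws) (word_error (size (labels w))).
Proof.
pose A i j := psum d w j i (fun t => tsum d ws (fun t' => e ((l, i, j) :: t ++ t'))).
pose B i j := splitsum c l w (fun w1 w2 => psum d w1 j j (fun t1 =>
  psum d w2 i i (fun t2 => tsum d ws (fun t' => e (t1 ++ t2 ++ t'))))).
have E i j : psum d w j i (fun t => tsum d ws (fun t' =>
    word_error (size (labels w)) ((l, i, j) :: t ++ t'))) =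
    A i j - N%:R^-1 * B i j.
  rewrite /A /B -psum_esplit -mulNr -psumZ -psumD.
  apply: eq_psum => t _ tw; rewrite tsum_esplit -tsumZ -tsumD.
  apply: eq_tsum => t' _.
  by rewrite /word_error -tw size_map take_size_cat ?drop_size_cat // mulNr.
have -> : tsum d ((map inr u ++ inl l :: w) :: ws) (word_error (size (labels w))) =
    N%:R^-1 * \sum_i (\prod_(x <- u) d x i) * \sum_j (A i j - N%:R^-1 * B i j).
  rewrite /=; congr (_ * _); apply: eq_bigr => i _; rewrite psum_inr /=.
  by congr (_ * _); apply: eq_bigr => j _; rewrite -E.
under eq_bigr => i _ do rewrite sumrB mulrBr.
rewrite sumrB mulrBr; congr (_ - _).
  by rewrite /=; congr (_ * _); apply: eq_bigr => i _; rewrite psum_inr.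
under [in RHS]eq_bigr => i _ do rewrite -mulr_sumr -splitsum_sum -!splitsumZ.
rewrite -splitsum_sum -splitsumZ.
apply: eq_splitsum => w1 l' w2 _; congr (_ * _) => /=; congr (_ * _).
rewrite (eq_bigr (fun j => \sum_i N%:R^-1 * (\prod_(x <- u) d x i) *
  psum d w1 j j (fun t1 => psum d w2 i i (fun t2 =>
    tsum d ws (fun t' => e (t1 ++ t2 ++ t')))))) => [|j _].
  rewrite exchange_big /=; apply: eq_bigr => i _.
  by rewrite -mulr_sumr -mulrA mulrCA.
under eq_bigr => i _ do rewrite -psumZ.
rewrite -psum_sum; apply: eq_psum => t1 _ _.
by rewrite mulr_sumr; apply: eq_bigr => i _; rewrite psum_inr mulrA.
Qed.

End SchwingerDysonFixed.

Local Open Scope classical_set_scope.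

Section Asymptotics.
Variables (F : numFieldType) (L : eqType) (D : Type) (c : L -> L -> F).
Notation V := (L + D)%type.
Notation edge N := (L * 'I_N * 'I_N)%type.
Variables (d : forall N, D -> 'I_N -> F) (Md : D -> F).
Arguments d : clear implicits.
Hypothesis Md_ge0 : forall x, 0 <= Md x.
Hypothesis d_le : forall N x i, `|d N x i| <= Md x.
Variable e : forall N, seq (edge N) -> F.
Arguments e : clear implicits.
Hypothesis e_nil : forall N, e N [::] = 1.
Hypothesis e_perm : forall N (t1 t2 : seq (edge N)), perm_eq t1 t2 -> e N t1 = e N t2.
Hypothesis e_cat : forall N (t1 t2 : seq (edge N)), [disjoint keys t1 & keys t2]%B ->
  e N (t1 ++ t2) = e N t1 * e N t2.
Hypothesis e_seq1 : forall N (x : edge N), e N [:: x] = 0.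
Hypothesis e_pair : forall N l l' (i j : 'I_N),
  e N [:: (l, i, j); (l', j, i)] = N%:R^-1 * c l l'.
(* [s N] stands for the square root of [N]. *)
Variable s : nat -> F.
Hypothesis s_ge0 : forall N, 0 <= s N.
Hypothesis s_sqr : forall N, s N ^+ 2 = N%:R.
Hypothesis e_bound : forall ls : seq L, exists (C : F) (N0 : nat), 0 <= C /\
  forall N, (N0 < N)%N -> forall t : seq (edge N), map label t = ls ->
    `|e N t| <= C * s N ^- size ls.

Lemma s_ge1 N : (0 < N)%N -> 1 <= s N.
Proof.
by move=> N0; rewrite -(@ler_pXn2r _ 2) // ?nnegrE // expr1n s_sqr ler1n.
Qed.

Lemma s_gt0 N : (0 < N)%N -> 0 < s N.
Proof. by move/s_ge1; apply: lt_le_trans. Qed.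

(** Removing two edges weakens the bound on [e] by [s N ^+ 2], which the factor $1/N$ restores; the
    exponent thus counts all letters, [l] included. The labels already passed in the induction are
    kept in [pre]. *)
Lemma esplit_bound (l : L) (pre ls post : seq L) : exists (C : F) (N0 : nat), 0 <= C /\
  forall N, (N0 < N)%N -> forall (i j : 'I_N) (t0 t t' : seq (edge N)),
    map label t0 = pre -> map label t = ls -> map label t' = post ->
    N%:R^-1 * `|esplit c l i j t (fun t1 t2 => e N (t0 ++ t1 ++ t2 ++ t'))| <=
    C * s N ^- (size pre + size ls + size post).+1.
Proof.
elim: ls pre => [|l' ls IH] pre.
  exists 0, 0%N; split=> // N N0 i j t0 [|//] t' _ _ _ /=.
  by rewrite normr0 mulr0 mul0r.
have [C1 [N1 [C10 H1]]] := e_bound (pre ++ ls ++ post).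
have [C2 [N2 [C20 H2]]] := IH (rcons pre l').
exists (`|c l l'| * C1 + C2), (maxn N1 N2); split; first by rewrite addr_ge0 ?mulr_ge0.
move=> N; rewrite gtn_max => /andP[N1N N2N] i j t0 [//|x t] t' tpre /= [xl' tls] tpost.
have N0 : (0 < N)%N by exact: leq_trans N1N.
have s0 := s_gt0 N0.
rewrite mulrDl; apply: le_trans (ler_wpM2l _ (ler_normD _ _)) _.
  by rewrite invr_ge0.
rewrite mulrDr; apply: lerD; last first.
  have := H2 N N2N i j (rcons t0 x) t t'.
  rewrite map_rcons tpre xl' size_rcons addSnnS => /(_ erefl tls tpost).
  apply: le_trans; rewrite ler_wpM2l ?invr_ge0 //.
  by under [in leRHS]eq_esplit => t1 _ t2 _ do rewrite cat_rcons.
case: ifP => _; last first.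
  by rewrite normr0 mulr0 !mulr_ge0 // invr_ge0 exprn_ge0.
rewrite normrM xl' -s_sqr.
have := H1 N N1N (t0 ++ t ++ t'); rewrite !map_cat tpre tls tpost => /(_ erefl) H.
rewrite mulrCA -mulrA ler_wpM2l //.
apply: le_trans (ler_wpM2l _ H) _; first by rewrite invr_ge0 exprn_ge0.
rewrite mulrCA ler_wpM2l // -invfM -exprD !size_cat.
by rewrite (_ : (2 + _)%N = (size pre + (size ls).+1 + size post).+1)//; lia.
Qed.

Lemma pairing_error_bound (l : L) (ls post : seq L) : exists (C : F) (N0 : nat), 0 <= C /\
  forall N, (N0 < N)%N -> forall (i j : 'I_N) (t t' : seq (edge N)),
    map label t = ls -> map label t' = post ->
    `|pairing_error c (e N) l i j t t'| <= C * s N ^- (size ls + size post).+1.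
Proof.
have [C1 [N1 [C10 H1]]] := e_bound (l :: ls ++ post).
have [C2 [N2 [C20 H2]]] := esplit_bound l [::] ls post.
exists (C1 + C2), (maxn N1 N2); split; first by rewrite addr_ge0.
move=> N; rewrite gtn_max => /andP[N1N N2N] i j t t' tls tpost.
apply: le_trans (ler_normB _ _) _; rewrite mulrDl; apply: lerD.
  by have := H1 N N1N ((l, i, j) :: t ++ t'); rewrite /= map_cat tls tpost size_cat; apply.
by rewrite normrM ger0_norm ?invr_ge0 //; apply: (H2 N N2N i j [::]).
Qed.

Lemma tsum_error_bound (u : seq D) l w ws : exists (C : F) (N0 : nat),
  forall N, (N0 < N)%N ->
  `|tsum (d N) ((map inr u ++ inl l :: w) :: ws) (e N) -
    splitsum c l w (fun w1 w2 =>
      tsum (d N) (w1 :: (map inr u ++ w2) :: ws) (e N))| <= C * (s N)^-1.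
Proof.
set ws0 := _ :: ws.
have [C [N0 [C0 H]]] := pairing_error_bound l (labels w) (flatten (map (@labels L D) ws)).
set n := (size (labels w) + _).+1 in H.
(* [n] counts all the letters and [q] the words containing one; [m] is the largest number v of
   vertices with $2v < 2q + n$. *)
pose q := (nlabelled ws).+1; pose m := (2 * q + n).-1./2.
exists (words_bound Md m ws0 * C), N0 => N N0N.
have Ngt0 : (0 < N)%N by apply: leq_trans N0N.
rewrite schwinger_dyson_error.
have CE : 0 <= C * s N ^- n by rewrite mulr_ge0 // invr_ge0 exprn_ge0.
have ws0E : labels (map inr u ++ inl l :: w) = l :: labels w.
  by rewrite labels_cat labels_inr.
have qE : nlabelled ws0 = q by rewrite /nlabelled /= ws0E.
have B : `|tsum (d N) ws0 (word_error c (e N) (size (labels w)))| <=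
    words_bound Md m ws0 * (N%:R ^- q * (C * s N ^- n * extensions F m (finset.set0 : {set 'I_N}))).
  rewrite -qE; apply: (tsum_bound Md_ge0 (@d_le N) Ngt0) => //.
  move=> t [[|t0 ts] [-> /=]] // [[i0 w0] cts] [t0E tsE].
  case: t0 t0E w0 => [|[[l1 i] j] t0]; rewrite ws0E // => -[lE t0E] /= /andP[/eqP ii0 w0].
  have {}lE : l1 = l := lE; subst l1 i0.
  rewrite finset.set0U /word_error /= -t0E size_map take_size_cat ?drop_size_cat //.
  have tsE' : map label (flatten ts) = flatten (map (@labels L D) ws).
    by rewrite map_flatten tsE.
  have [->|err0] := eqVneq (pairing_error c (e N) l i j t0 (flatten ts)) 0.
    by rewrite normr0 mulr_ge0 ?extensions_ge0.
  have := H N N0N i j t0 (flatten ts) t0E tsE'; rewrite -/n => Herr.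
  have := pairing_error_vertices (@e_perm N) (@e_cat N) (@e_seq1 N) (@e_pair N) w0 cts err0.
  have -> : count (fun t => t != [::]) ts = nlabelled ws.
    have <- : count (fun ls => ls != [::]) (map (map label) ts) = nlabelled ws.
      by rewrite tsE count_map.
    by rewrite count_map; apply: eq_count => -[].
  rewrite -(size_map label t0) t0E -(size_map label (flatten ts)) tsE' -/n -/q => vm.
  apply: (le_trans Herr); rewrite ler_peMr // /extensions ifT.
    by rewrite exprn_ege1 // ler1n.
  by move: vm; rewrite /m; set v := #|_|; lia.
apply: (le_trans B); rewrite -[leRHS]mulrA ler_wpM2l ?words_bound_ge0 //.
(* [N ^ m] equals [s N ^ (2 * m)], and $2m \le 2q + n - 1$ leaves one factor [(s N)^-1]. *)
rewrite /extensions cards0 subn0 leq0n -s_sqr -!exprM -mulrA mulrCA ler_wpM2l //.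
have s0 := s_gt0 Ngt0.
rewrite mulrA -invfM -exprD ler_pdivrMl ?exprn_gt0 // ler_pdivlMr //.
rewrite -exprSr ler_weXn2l ?s_ge1 //.
by rewrite /m; lia.
Qed.

Hypothesis s_cvg : ((fun N => (s N)^-1) @ \oo --> (0 : F))%classic.
Variable lim_d : seq D -> F.
Hypothesis d_cvg : forall u, ((fun N => N%:R^-1 * \sum_i \prod_(x <- u) d N x i)
  @ \oo --> lim_d u)%classic.

Definition trace_moment (ws : seq (seq V)) (N : nat) : F := tsum (d N) ws (e N).
(** [lim] is total, so this makes sense before convergence is known; [cvg_limit_moment] shows that
    the limit is attained. *)
Definition limit_moment (w : seq V) : F := lim (trace_moment [:: w] @ \oo)%classic.

Lemma limit_momentE w x : (trace_moment [:: w] @ \oo --> x)%classic -> limit_moment w = x.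
Proof. by apply: cvg_lim; exact: norm_hausdorff. Qed.

Lemma cvg_splitsum l w (Phi : nat -> seq V -> seq V -> F) (Psi : seq V -> seq V -> F) :
  (forall a l' b, w = a ++ inl l' :: b -> ((fun N => Phi N a b) @ \oo --> Psi a b)%classic) ->
  ((fun N => splitsum c l w (Phi N)) @ \oo --> splitsum c l w Psi)%classic.
Proof.
elim: w Phi Psi => [|x w IHw] Phi Psi H /=; first exact: cvg_cst.
apply: cvgD; last by apply: IHw => a l' b wE; apply: (H (x :: a) l'); rewrite wE.
case: x H => [l'|x] H; last exact: cvg_cst.
by apply: cvgM; [exact: cvg_cst | exact: (H [::] l')].
Qed.

Lemma word_decomp (w : seq V) : (exists u, w = map inr u) \/
  (exists u l w', w = map inr u ++ inl l :: w').
Proof.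
elim: w => [|[l|x] w IHw]; first by left; exists [::].
  by right; exists [::], l, w.
case: IHw => [[u ->]|[u [l [w' ->]]]]; first by left; exists (x :: u).
by right; exists (x :: u), l, w'.
Qed.

Lemma cvg_tsum_error (u : seq D) l w ws :
  ((fun N => trace_moment ((map inr u ++ inl l :: w) :: ws) N -
    splitsum c l w (fun w1 w2 => trace_moment (w1 :: (map inr u ++ w2) :: ws) N))
   @ \oo --> (0 : F))%classic.
Proof.
have [C [N0 H]] := tsum_error_bound u l w ws.
have C0 : ((fun N => C * (s N)^-1) @ \oo --> (0 : F))%classic.
  by rewrite -(mulr0 C); apply: cvgM; [exact: cvg_cst | exact: s_cvg].
apply/cvgr0Pnorm_lt => eps eps0; near=> N.
have HN := H N; apply: (le_lt_trans (HN _)).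
  by near: N; exists N0.+1.
have : `|C * (s N)^-1| < eps.
  by near: N; move/cvgr0Pnorm_lt: C0; apply.
rewrite ger0_norm // (le_trans (normr_ge0 _) (HN _)) //.
by near: N; exists N0.+1.
Unshelve. all: by end_near. Qed.

(** Removing a pair loses two letters and gains one word; removing a word in the [D]'s loses one
    word. Either way the sum decreases. *)
Definition nletters (ws : seq (seq V)) : nat := (sumn (map (fun w => size (labels w)) ws) + size ws)%N.

Lemma cvg_trace_moment_nil : (trace_moment [::] @ \oo --> (1 : F))%classic.
Proof.
have -> : trace_moment [::] = cst 1 by apply: funext => N; rewrite /trace_moment /= e_nil.
exact: cvg_cst.
Qed.

Lemma cvg_trace_moment_inr (u : seq D) ws x :
  (trace_moment ws @ \oo --> x)%classic ->
  (trace_moment (map inr u :: ws) @ \oo --> lim_d u * x)%classic.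
Proof.
move=> wsx.
have -> : trace_moment (map inr u :: ws) = (fun N =>
    N%:R^-1 * (\sum_i \prod_(x <- u) d N x i) * trace_moment ws N).
  by apply: funext => N; exact: tsum_inr.
by apply: cvgM.
Qed.

Lemma limit_moment_inr (u : seq D) : limit_moment (map inr u) = lim_d u.
Proof.
by apply: limit_momentE; rewrite -[lim_d u]mulr1;
   apply/cvg_trace_moment_inr/cvg_trace_moment_nil.
Qed.

(** With [ws] empty this identifies the moment of the first word; with [ws] arbitrary it shows that
    this same moment factors out of the limit. *)
Lemma cvg_trace_moment_split (u : seq D) l w ws :
  (forall w1 l' w2, w = w1 ++ inl l' :: w2 ->
    (trace_moment (w1 :: (map inr u ++ w2) :: ws) @ \oo -->
     limit_moment w1 * (limit_moment (map inr u ++ w2) * \prod_(w <- ws) limit_moment w))%classic) ->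
  (trace_moment ((map inr u ++ inl l :: w) :: ws) @ \oo -->
    splitsum c l w (fun w1 w2 => limit_moment w1 * limit_moment (map inr u ++ w2)) *
    \prod_(w <- ws) limit_moment w)%classic.
Proof.
move=> H; rewrite mulrC -splitsumZ.
have -> : trace_moment ((map inr u ++ inl l :: w) :: ws) = (fun N =>
  (trace_moment ((map inr u ++ inl l :: w) :: ws) N -
    splitsum c l w (fun w1 w2 => trace_moment (w1 :: (map inr u ++ w2) :: ws) N)) +
  splitsum c l w (fun w1 w2 => trace_moment (w1 :: (map inr u ++ w2) :: ws) N)).
  by apply: funext => N; rewrite subrK.
rewrite -[splitsum _ _ _ _ in X in _ --> X]add0r; apply: cvgD; first exact: cvg_tsum_error.
by apply: cvg_splitsum => w1 l' w2 wE; rewrite mulrC -mulrA; exact: H wE.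
Qed.

Lemma cvg_trace_moment ws :
  (trace_moment ws @ \oo --> \prod_(w <- ws) limit_moment w)%classic.
Proof.
have [n] := ubnP (nletters ws); elim: n ws => // n IHn [|w ws] ltn.
  by rewrite big_nil; exact: cvg_trace_moment_nil.
case: (word_decomp w) ltn => [[u ->]|[u [l [w' ->]]]] ltn.
  rewrite big_cons limit_moment_inr; apply/cvg_trace_moment_inr/IHn.
  by move: ltn; rewrite /nletters /= addnS; lia.
have split vs : (nletters ((map inr u ++ inl l :: w') :: vs) < n.+1)%N ->
    (trace_moment ((map inr u ++ inl l :: w') :: vs) @ \oo -->
    splitsum c l w' (fun w1 w2 => limit_moment w1 * limit_moment (map inr u ++ w2)) *
    \prod_(w <- vs) limit_moment w)%classic.
  move=> ltvs; apply: cvg_trace_moment_split => w1 l' w2 wE.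
  have := IHn (w1 :: (map inr u ++ w2) :: vs); rewrite !big_cons; apply; move: ltvs.
  rewrite /nletters /= wE !labels_cat /= !labels_cat labels_inr /= !size_cat /=; lia.
have -> : \prod_(w <- (map inr u ++ inl l :: w') :: ws) limit_moment w =
    splitsum c l w' (fun w1 w2 => limit_moment w1 * limit_moment (map inr u ++ w2)) *
    \prod_(w <- ws) limit_moment w.
  rewrite big_cons; congr (_ * _); apply: limit_momentE.
  have := split [::]; rewrite big_nil mulr1; apply.
  by move: ltn; rewrite /nletters /=; lia.
exact: split.
Qed.

Lemma cvg_limit_moment w : (trace_moment [:: w] @ \oo --> limit_moment w)%classic.
Proof. by have := @cvg_trace_moment [:: w]; rewrite big_seq1. Qed.

Lemma limit_moment_schwinger_dyson (u : seq D) l w :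
  limit_moment (map inr u ++ inl l :: w) =
  splitsum c l w (fun w1 w2 => limit_moment w1 * limit_moment (map inr u ++ w2)).
Proof.
apply: limit_momentE.
have := @cvg_trace_moment_split u l w [::]; rewrite big_nil mulr1.
apply=> w1 l' w2 _; have := @cvg_trace_moment [:: w1, map inr u ++ w2 & [::]].
by rewrite !big_cons big_nil.
Qed.

End Asymptotics.

Local Open Scope classical_set_scope.
Local Open Scope ring_scope.
Local Open Scope complex_scope.

(** * From centred words to elements of the generated subalgebras *)

Section Freeness.
Variables (R : realType) (B : ncProbSpace R) (L D K : Type) (col : L -> K).
Notation V := (L + D)%type.
Notation C := (R[i]).
Notation phi := (nc_state B).
Variables (x : V -> B) (m : seq V -> C).
Hypothesis phi_x : forall w, phi (\prod_(v <- w) x v) = m w.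
Notation mon w := (\prod_(v <- w) x v).
Notation cmon w := (mon w - m w *: 1).

Lemma state_prod_centered ws (y : B) :
  phi (y * \prod_(w <- ws) cmon w) = cexp m ws (fun t => phi (y * mon t)).
Proof.
elim: ws y => [|w ws IHws] y; first by rewrite /= !big_nil.
rewrite big_cons mulrA IHws /= -IHws.
under [in RHS]eq_cexp => t do rewrite big_cat /= mulrA.
rewrite -(IHws (y * mon w)) mulrBr -scalerAr mulr1 -IHws mulrBl linearB.
by rewrite -scalerAl linearZ.
Qed.

(** A span built one term at a time, so that linear statements are proved by induction. *)
Inductive word_span (o : option K) : B -> Prop :=
| word_span0 : word_span o 0
| word_spanD k w b : mono col o w -> word_span o b -> word_span o (k *: mon w + b).

Lemma word_span_word o w : mono col o w -> word_span o (mon w).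
Proof.
move=> ow; rewrite -[mon w]addr0 -[mon w]scale1r.
by apply: word_spanD => //; apply: word_span0.
Qed.

Lemma word_span_lin o k b b' :
  word_span o b -> word_span o b' -> word_span o (k *: b + b').
Proof.
move=> ob ob'; elim: ob => [|k' w b0 ow _ IH]; first by rewrite scaler0 add0r.
by rewrite scalerDr -addrA scalerA; apply: word_spanD.
Qed.

Lemma word_spanM o b b' : word_span o b -> word_span o b' -> word_span o (b * b').
Proof.
move=> ob ob'; elim: ob => [|k w b0 ow _ IH].
  by rewrite mul0r; apply: word_span0.
rewrite mulrDl -scalerAl; apply: word_span_lin => //.
elim: ob' => [|k' w' b1 ow' _ IH']; first by rewrite mulr0; apply: word_span0.
rewrite mulrDr -scalerAr -big_cat.
by apply: word_spanD => //; apply/mono_cat.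
Qed.

Lemma generated_subalgebra_span (S : set B) o :
  (forall b, S b -> exists2 v, color col v = o & b = x v) ->
  generated_subalgebra S `<=` word_span o.
Proof.
move=> Sx; apply: smallest_sub => [|b /Sx[v vo ->]].
  split; first by rewrite inE; have /= := @word_span_word o [::] I; rewrite big_nil.
    by move=> k b b'; rewrite !inE; apply: word_span_lin.
  by move=> b b'; rewrite !inE; apply: word_spanM.
by have := @word_span_word o [:: v] (conj vo I); rewrite big_seq1.
Qed.

(** Subtracting its state from a combination of monomials centres each monomial separately; an
    element of state zero is therefore a combination of the [cmon w]. *)
Lemma word_span_centered o b y z : word_span o b -> phi b = 0 ->
  (forall w, mono col o w -> phi (y * cmon w * z) = 0) -> phi (y * b * z) = 0.
Proof.
move=> ob phib0 H.
suff : phi (y * (b - phi b *: 1) * z) = 0 by rewrite phib0 scale0r subr0.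
elim: ob {phib0} => [|k w b0 ow _ IH].
  by rewrite linear0 scale0r subr0 mulr0 mul0r linear0.
have -> : k *: mon w + b0 - phi (k *: mon w + b0) *: 1 =
    k *: cmon w + (b0 - phi b0 *: 1).
  rewrite linearP phi_x scalerBr scalerA [X in X *: 1](_ : _ = k * m w + phi b0) //.
  by rewrite scalerDl opprD addrACA.
by rewrite mulrDr mulrDl -scalerAr -scalerAl linearP IH H // addr0 mulr0.
Qed.

Fixpoint centered (bs : seq (option K * B)) : Prop :=
  if bs is (o, b) :: bs' then [/\ word_span o b, phi b = 0 & centered bs']
  else True.

Hypothesis cexp_m : forall ws, alt_words col ws -> ws <> [::] ->
  cexp m (map snd ws) m = 0.

(** Elements of the subalgebras are replaced by centred words one at a time from the left. Those
    done are in [ws]; the others enter the colour condition as empty words, of which only the colour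
    matters. *)
Lemma state_alternating ws bs :
  alt_words col (ws ++ [seq (p.1, [::]) | p <- bs]) ->
  (0 < size ws + size bs)%N -> centered bs ->
  phi (\prod_(w <- map snd ws) cmon w * \prod_(p <- bs) p.2) = 0.
Proof.
elim: bs ws => [|[ o b] bs IH] ws /=.
  rewrite cats0 big_nil mulr1 addn0 => aws wsN0 _.
  rewrite -[X in phi X]mul1r state_prod_centered -[RHS](cexp_m aws).
    by apply: eq_cexp => t; rewrite mul1r phi_x.
  by case: (ws) wsN0.
move=> a0 _ [ob b0 cbs]; rewrite big_cons mulrA.
apply: (word_span_centered ob b0) => w ow.
have := IH (rcons ws (o, w)); rewrite map_rcons big_rcons; apply => //.
  by rewrite cat_rcons; apply: alt_words_subst a0.
by rewrite size_rcons.
Qed.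

Lemma free_family_alternating (S : option K -> set B) :
  (forall o b, S o b -> exists2 v, color col v = o & b = x v) ->
  free_family S.
Proof.
move=> Sx n v a n0 agen a0 vN.
have H k j : (j + k <= n)%N ->
    alt_words col [seq (v r, [::] : seq V) | r <- iota j k] /\
    centered [seq (v r, a r) | r <- iota j k].
  elim: k j => [|k IHk] j jn //=; have [|IHa IHc] := IHk j.+1; first by lia.
  split; split => //.
  - by case: k {IHk} jn IHa IHc => //= k jn _ _; apply: vN; lia.
  - by apply: (generated_subalgebra_span _ (agen j _)) => [b|]; [apply: Sx | lia].
  - by apply: a0; lia.
have [Ha Hc] := H n 0 (leqnn n).
have := @state_alternating [::] [seq (v r, a r) | r <- iota 0 n].
rewrite -map_comp /= big_nil mul1r big_map /= size_map size_iota.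
rewrite -(big_mkord xpredT a) /index_iota subn0; exact.
Qed.
End Freeness.

(** * Independence and moments *)

Section Factorization.
Context d (T : measurableType d) (R : realType) (P : probability T R).
Import HBNNSimple.

Definition sigma_measurable (A : set (set T)) (f : T -> R) : Prop :=
  @measurable_fun _ _ (g_sigma_algebraType A) R setT f.

Lemma sub_sigma_measurable (A : set (set T)) : <<s A >> `<=` measurable ->
  forall g : T -> R, sigma_measurable A g ->
  measurable_fun setT g.
Proof. by move=> sA g mg _ Y mY; apply: sA; exact: mg. Qed.

(** Passage from indicators to nonnegative functions by simple functions and monotone convergence;
    [k] stands for the integral of [g]. *)
Lemma integral_mul_sigma (A : set (set T)) (g : T -> R) (k : R) :
  <<s A >> `<=` measurable ->
  (forall x, 0 <= g x) -> measurable_fun setT g -> 0 <= k ->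
  (forall B, <<s A >> B ->
    (\int[P]_x (\1_B x * g x)%:E = P B * k%:E)%E) ->
  forall f : T -> R, (forall x, 0 <= f x) ->
  sigma_measurable A f ->
  (\int[P]_x (f x * g x)%:E = (\int[P]_x (f x)%:E) * k%:E)%E.
Proof.
move=> sA g0 mg k0 H f f0 mf.
have /measurable_EFinP mf' := mf.
(* Approximating within the generated sigma-algebra keeps the level sets of [h n] in [<<s A>>],
   where the hypothesis on [g] applies. *)
pose h : {nnsfun g_sigma_algebraType A >-> R}^nat := nnsfun_approx measurableT mf'.
have mh n : measurable_fun setT (h n : T -> R).
  by apply: (sub_sigma_measurable sA); exact: measurable_funP.
have hf x : (h n x)%:E @[n --> \oo] --> (f x)%:E.
  by apply: (cvg_nnsfun_approx _ mf') => // y _; rewrite lee_fin.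
have ndh x : {homo (fun n => h n x) : a b / (a <= b)%N >-> a <= b}.
  by move=> a b ab; exact/lefP/nd_nnsfun_approx.
have hE n x : h n x = \sum_(y \in range (h n)) (y * \1_(h n @^-1` [set y]) x).
  exact: fimfunE.
have mB n y : <<s A >> (h n @^-1` [set y]) by exact: (@measurable_funPTI _ _ _ _ (h n) _ (measurable_set1 y)).
have y0 n y x : 0 <= y * \1_(h n @^-1` [set y]) x.
  rewrite indicE; case: (boolP (x \in _)); rewrite ?mulr0 // mulr1.
  by rewrite inE /= => <-.
(* Used for [g] and for the constant 1, so that both integrals reduce to sums over the same level
   sets. *)
have step n (u : T -> R) (c : R) : (forall x, 0 <= u x) -> measurable_fun setT u ->
    (forall B, <<s A >> B -> (\int[P]_x (\1_B x * u x)%:E = P B * c%:E)%E) ->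
    (\int[P]_x (h n x * u x)%:E =
     \sum_(y \in range (h n)) (y%:E * (P (h n @^-1` [set y]) * c%:E)))%E.
  move=> u0 mu Hu.
  transitivity (\int[P]_x (\sum_(y \in range (h n))
      (y * \1_(h n @^-1` [set y]) x * u x)%:E))%E.
    apply: eq_integral => x _; rewrite {1}hE fsumEFin //; congr EFin.
    by rewrite !fsbig_finite //= mulr_suml.
  rewrite ge0_integral_fsum //; last 2 first.
  - move=> y; apply/measurable_EFinP; apply: measurable_funM => //.
    by apply: measurable_funM => //; apply: measurable_indic; exact: sA.
  - by move=> y x _; rewrite lee_fin mulr_ge0.
  apply: eq_fsbigr => y; rewrite inE => -[x0 _ <-].
  under eq_integral do rewrite -mulrA EFinM.
  rewrite ge0_integralZl //= ?lee_fin //.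
  - by rewrite Hu.
  - apply/measurable_EFinP; apply: measurable_funM => //.
    by apply: measurable_indic; exact: sA.
  - by move=> x _; rewrite lee_fin mulr_ge0.
have stepE n : (\int[P]_x (h n x * g x)%:E = (\int[P]_x (h n x)%:E) * k%:E)%E.
  rewrite (step n g k) //.
  under [in RHS]eq_integral do rewrite -[h n _]mulr1.
  rewrite (step n (cst 1) 1) //; last first.
    move=> B /sA mB'; under eq_integral do rewrite mulr1.
    by rewrite integral_indic // setIT mule1.
  rewrite ge0_mule_fsuml => [|y]; last first.
    rewrite mule1; have [y_ge0|y_lt0] := leP 0 y; first by rewrite mule_ge0 ?lee_fin.
    rewrite (_ : h n @^-1` [set y] = set0) ?measure0 ?mule0 //.
    by apply/seteqP; split => // x /= hy; have : 0 <= h n x by []; rewrite hy leNgt y_lt0.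
  by apply: eq_fsbigr => y _; rewrite mule1 muleA.
have L1 : (\int[P]_x (h n x * g x)%:E)%E @[n --> \oo] --> (\int[P]_x (f x * g x)%:E)%E.
  rewrite [X in _ --> X](_ : _ = \int[P]_x lim ((h n x * g x)%:E @[n --> \oo]))%E.
    apply: cvg_monotone_convergence => //.
    - by move=> n; apply/measurable_EFinP; apply: measurable_funM.
    - by move=> n x _; rewrite lee_fin mulr_ge0.
    - by move=> x _ a b ab; rewrite lee_fin ler_wpM2r // ndh.
  apply: eq_integral => x _; apply/esym/cvg_lim => //.
  by rewrite EFinM; under eq_fun do rewrite EFinM; apply: cvgeZr.
have L2 : ((\int[P]_x (h n x)%:E) * k%:E)%E @[n --> \oo] --> ((\int[P]_x (f x)%:E) * k%:E)%E.
  apply: cvgeZr => //.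
  rewrite [X in _ --> X](_ : _ = \int[P]_x lim ((h n x)%:E @[n --> \oo]))%E.
    apply: cvg_monotone_convergence => //.
    - by move=> n; apply/measurable_EFinP.
    - by move=> n x _; rewrite lee_fin.
    - by move=> x _ a b ab; rewrite lee_fin ndh.
  by apply: eq_integral => x _; apply/esym/cvg_lim.
have L3 : (\int[P]_x (h n x * g x)%:E)%E @[n --> \oo] --> ((\int[P]_x (f x)%:E) * k%:E)%E.
  by under eq_fun do rewrite stepE.
by apply: cvg_unique L1 L3.
Qed.
End Factorization.

(** * Functions with moments of all orders and their complex expectation *)

Section Moments.
Context d (T : measurableType d) (R : realType) (P : probability T R).
Notation C := (R[i]).

Definition all_moments (f : T -> R) : Prop := measurable_fun setT f /\
  forall n : nat, P.-integrable setT (fun x => (`|f x| ^+ n)%:E).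

Lemma all_moments_bounded (f : T -> R) : measurable_fun setT f ->
  (forall n, exists2 g : T -> R, P.-integrable setT (EFin \o g) &
     forall x, `|f x| ^+ n <= g x) -> all_moments f.
Proof.
move=> mf H; split=> // n; have [g ig fg] := H n.
apply: le_integrable ig => //.
  by apply/measurable_EFinP; apply: measurable_funX; exact: measurableT_comp.
move=> x _ /=; rewrite lee_fin (le_trans _ (ler_norm _)) //.
by rewrite ger0_norm ?exprn_ge0.
Qed.

Lemma all_moments_le (f g : T -> R) : measurable_fun setT f ->
  (forall x, `|f x| <= `|g x|) -> all_moments g -> all_moments f.
Proof.
move=> mf fg [_ ig]; apply: all_moments_bounded => // n.
exists (fun x => `|g x| ^+ n) => [|x]; first exact: ig.
by rewrite lerXn2r ?nnegrE.
Qed.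

Lemma all_moments_cst (a : R) : all_moments (cst a).
Proof.
by split=> // n; exact: (finite_measure_integrable_cst P (`|a| ^+ n) measurableT).
Qed.

Lemma all_momentsM (f g : T -> R) : all_moments f -> all_moments g ->
  all_moments (fun x => f x * g x).
Proof.
move=> [mf If] [mg Ig]; apply: all_moments_bounded => [|n].
  exact: measurable_funM.
exists (fun x => `|f x| ^+ (n * 2) + `|g x| ^+ (n * 2)).
  by have := integrableD measurableT (If (n * 2)%N) (Ig (n * 2)%N).
move=> x; rewrite normrM exprMn !exprM.
by set a := _ ^+ n; set b := _ ^+ n; nra.
Qed.

Lemma all_momentsD (f g : T -> R) : all_moments f -> all_moments g ->
  all_moments (fun x => f x + g x).
Proof.
move=> [mf If] [mg Ig]; apply: all_moments_bounded => [|n].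
  exact: measurable_funD.
exists (fun x => 2 ^+ n * (`|f x| ^+ n + `|g x| ^+ n)).
  have := integrableZl measurableT (2 ^+ n) (integrableD measurableT (If n) (Ig n)).
  by apply: eq_integrable => // x _.
move=> x; apply: (@le_trans _ _ ((2 * Num.max `|f x| `|g x|) ^+ n)).
  rewrite lerXn2r ?nnegrE ?mulr_ge0 ?le_max ?normr_ge0 //.
  apply: (le_trans (ler_normD _ _)); rewrite mulr_natl mulr2n.
  by apply: lerD; rewrite le_max lexx ?orbT.
rewrite exprMn ler_wpM2l ?exprn_ge0 //.
by rewrite /Order.max; case: ifP => _; rewrite ?lerDr ?lerDl exprn_ge0.
Qed.

Lemma all_momentsN (f : T -> R) : all_moments f -> all_moments (fun x => - f x).
Proof.
move=> Jf; apply: (all_moments_le _ _ Jf) => [|x]; last by rewrite normrN.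
by apply: measurable_funN; case: Jf.
Qed.

Lemma all_moments_integrable (f : T -> R) : all_moments f ->
  P.-integrable setT (EFin \o f).
Proof.
move=> [mf /(_ 1%N) If]; apply: le_integrable If => //.
  exact/measurable_EFinP.
by move=> x _ /=; rewrite expr1 normr_id.
Qed.

Definition call_moments (f : T -> C) : Prop :=
  all_moments (fun x => complex.Re (f x)) /\ all_moments (fun x => complex.Im (f x)).

Lemma normc_Re (z : C) : `|complex.Re z| <= complex.Re `|z|.
Proof.
by case: z => a b; rewrite normc_def /= -sqrtr_sqr ler_wsqrtr // lerDl sqr_ge0.
Qed.

Lemma normc_Im (z : C) : `|complex.Im z| <= complex.Re `|z|.
Proof.
by case: z => a b; rewrite normc_def /= -sqrtr_sqr ler_wsqrtr // lerDr sqr_ge0.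
Qed.

Lemma Re_norm_ge0 (z : C) : 0 <= complex.Re `|z|.
Proof. by apply: le_trans (normc_Re z). Qed.

Lemma Linfm_call_moments (f : T -> C) : Linfm P f -> call_moments f.
Proof.
move=> [mR mI fL].
have H n : exists2 g : T -> R, P.-integrable setT (EFin \o g) &
    forall x, complex.Re `|f x| ^+ n <= g x.
  case: n => [|n].
    exists (cst 1) => [|x]; last by rewrite expr0.
    exact: (finite_measure_integrable_cst P 1 measurableT).
  have n1 : 1 <= n.+1%:R :> R by rewrite ler1n.
  exists (fun x => complex.Re `|f x| ^+ n.+1) => //.
  have := Lfun_integrable n1 (fL _ n1); apply: eq_integrable => // x _ /=.
  by rewrite powR_mulrn ?normr_ge0 // ger0_norm ?Re_norm_ge0.
split; apply: all_moments_bounded => // n; have [g ig fg] := H n;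
  exists g => // x; apply: le_trans (fg x); rewrite lerXn2r ?nnegrE ?Re_norm_ge0 //.
- exact: normc_Re.
- exact: normc_Im.
Qed.

Lemma call_momentsM (f g : T -> C) : call_moments f -> call_moments g ->
  call_moments (fun x => f x * g x).
Proof.
move=> [fR fI] [gR gI].
have E x : f x * g x = (complex.Re (f x) * complex.Re (g x) - complex.Im (f x) * complex.Im (g x)) +i*
  (complex.Re (f x) * complex.Im (g x) + complex.Im (f x) * complex.Re (g x)).
  by case: (f x) => a b; case: (g x) => a' b'.
split; under eq_fun do rewrite E /=.
  by apply: all_momentsD; [|apply: all_momentsN]; apply: all_momentsM.
by apply: all_momentsD; apply: all_momentsM.
Qed.

Lemma call_momentsD (f g : T -> C) : call_moments f -> call_moments g ->
  call_moments (fun x => f x + g x).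
Proof.
move=> [fR fI] [gR gI].
by split; under eq_fun do rewrite raddfD /=; apply: all_momentsD.
Qed.

Lemma call_moments_cst (z : C) : call_moments (cst z).
Proof. by split; exact: all_moments_cst. Qed.

Lemma call_moments_real (f : T -> R) : all_moments f -> call_moments (fun x => (f x)%:C).
Proof. by move=> If; split => //=; exact: all_moments_cst. Qed.

Lemma call_moments_sum (A : Type) (r : seq A) (f : A -> T -> C) :
  (forall a, call_moments (f a)) -> call_moments (fun x => \sum_(a <- r) f a x).
Proof.
move=> H; elim: r => [|a r IH].
  by under eq_fun do rewrite big_nil; exact: call_moments_cst.
by under eq_fun do rewrite big_cons; exact: call_momentsD.
Qed.

Lemma call_moments_prod (A : Type) (r : seq A) (f : A -> T -> C) :
  (forall a, call_moments (f a)) -> call_moments (fun x => \prod_(a <- r) f a x).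
Proof.
move=> H; elim: r => [|a r IH].
  by under eq_fun do rewrite big_nil; exact: call_moments_cst.
by under eq_fun do rewrite big_cons; exact: call_momentsM.
Qed.

Lemma cexpectD (f g : T -> C) : call_moments f -> call_moments g ->
  cexpect P (fun x => f x + g x) = cexpect P f + cexpect P g.
Proof.
move=> [fR fI] [gR gI]; rewrite /cexpect.
under eq_Rintegral do rewrite raddfD /=.
under [X in _ +i* X]eq_Rintegral do rewrite raddfD /=.
by rewrite !RintegralD //; try exact: all_moments_integrable.
Qed.

Lemma cexpectZ (z : C) (f : T -> C) : call_moments f ->
  cexpect P (fun x => z * f x) = z * cexpect P f.
Proof.
move=> [fR fI]; rewrite /cexpect; case: z => a b.
have iR := all_moments_integrable fR; have iI := all_moments_integrable fI.
have ZR (k : R) := all_moments_integrable (all_momentsM (all_moments_cst k) fR).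
have ZI (k : R) := all_moments_integrable (all_momentsM (all_moments_cst k) fI).
have E x : (a +i* b) * f x = (a * complex.Re (f x) - b * complex.Im (f x)) +i*
  (a * complex.Im (f x) + b * complex.Re (f x)) by case: (f x) => a' b'.
under eq_Rintegral do rewrite E /=.
under [X in _ +i* X]eq_Rintegral do rewrite E /=.
have -> := RintegralB measurableT (ZR a) (ZI b).
have -> := RintegralD measurableT (ZI a) (ZR b).
by rewrite !RintegralZl.
Qed.

Lemma cexpect_cst (z : C) : cexpect P (cst z) = z.
Proof.
have E (a : R) : Rintegral P setT (cst a) = a.
  by rewrite Rintegral_cst //= probability_setT mulr1.
by rewrite /cexpect !E; case: z.
Qed.

Lemma cexpect_sum (A : Type) (r : seq A) (f : A -> T -> C) :
  (forall a, call_moments (f a)) ->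
  cexpect P (fun x => \sum_(a <- r) f a x) = \sum_(a <- r) cexpect P (f a).
Proof.
move=> H; elim: r => [|a r IH].
  rewrite big_nil; under eq_fun do rewrite big_nil.
  exact: (cexpect_cst 0).
rewrite big_cons -IH -cexpectD //; last exact: call_moments_sum.
by under eq_fun do rewrite big_cons.
Qed.

Lemma cexpect_real (f : T -> R) : cexpect P (fun x => (f x)%:C) = (Rintegral P setT f)%:C.
Proof. by rewrite /cexpect /= Rintegral_cst // mul0r. Qed.

End Moments.

Section Independence.
Context d (T : measurableType d) (R : realType) (P : probability T R).
Notation C := (R[i]).
Notation E f := (Rintegral P setT f).
Variables (V : finType) (D : {set V}) (A : V -> set (set T)).
Hypothesis A_measurable : forall v, <<s A v >> `<=` measurable.
Hypothesis A_indep : forall (S : {set V}) (B : V -> set T), S \subset D ->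
  (forall v, v \in S -> <<s A v >> (B v)) ->
  P (\bigcap_(v in [set` S]) B v) = (\prod_(v in S) P (B v))%E.

(** Independence is given for sets, so functions are treated one at a time: by [integral_mul_sigma]
    the one at [p] may be replaced by the indicator of a set of its sigma-algebra, and [p] moves
    from [ps] to [qs]. Once [ps] is empty only indicators remain. *)
Lemma integral_prod_indep (ps qs : seq V) (B : V -> set T) (f : V -> T -> R) :
  uniq (ps ++ qs) -> {subset ps ++ qs <= D} ->
  (forall v, <<s A v >> (B v)) ->
  (forall v x, 0 <= f v x) -> (forall v, sigma_measurable (A v) (f v)) ->
  (forall v, all_moments P (f v)) ->
  (\int[P]_x ((\prod_(q <- qs) \1_(B q) x) * \prod_(p <- ps) f p x)%:E =
   ((\prod_(q <- qs) fine (P (B q))) * \prod_(p <- ps) E (f p))%:E)%E.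
Proof.
move=> + + + f0 fA fJ; elim: ps qs B => [|p ps IH] qs B /= uq sD BA.
  under eq_integral do rewrite big_nil mulr1.
  rewrite big_nil mulr1.
  pose S := [set q in qs]%SET.
  have SE F : (\prod_(q <- qs) F q)%R = \prod_(q in S) F q :> R.
    by rewrite (big_uniq _ uq); apply: eq_bigl => q; rewrite inE.
  transitivity (P (\bigcap_(v in [set` S]) B v)).
    rewrite -[X in P X]setIT -integral_indic //; last first.
      by apply: fin_bigcap_measurable => // q _; apply: A_measurable.
    apply: eq_integral => x _; congr EFin; rewrite SE indicE.
    case: (boolP (x \in _)).
      rewrite inE => xB; rewrite big1 // => q qS.
      by rewrite indicE mem_set //; apply: xB.
    move/negP; rewrite inE -SE => /existsNP[q /not_implyP[/= qS xB]].
    by rewrite (bigD1_seq q) //= ?indicE ?memNset ?mul0r //; move: qS; rewrite inE.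
  rewrite A_indep //; last by apply/fintype.subsetP => q; rewrite inE; exact: sD.
  rewrite SE; elim/big_ind2: _ => // [x1 y1 x2 y2 -> ->|q _]; first by rewrite EFinM.
  by rewrite fineK // fin_num_measure //; exact: A_measurable.
case/andP: uq => pn uq.
have sD' : {subset ps ++ qs <= D} by move=> v vp; apply: sD; rewrite inE vp orbT.
pose g x := (\prod_(q <- qs) \1_(B q) x) * \prod_(p <- ps) f p x.
pose k := (\prod_(q <- qs) fine (P (B q))) * \prod_(p <- ps) E (f p).
have Ef0 v : 0 <= E (f v) by apply: Rintegral_ge0.
have g0 x : 0 <= g x by rewrite mulr_ge0 // prodr_ge0 // => q _; rewrite indicE.
have k0 : 0 <= k by rewrite mulr_ge0 // prodr_ge0 // => q _; rewrite fine_ge0.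
have mg : measurable_fun setT g.
  apply: measurable_funM; apply: measurable_prod => q _.
    by apply: measurable_indic; exact: A_measurable.
  by case: (fJ q).
have := @integral_mul_sigma _ T R P (A p) g k (A_measurable (v := p)) g0 mg k0.
move=> /(_ _ (f p) (f0 p) (fA p)) H.
transitivity (\int[P]_x (f p x * g x)%:E)%E.
  by apply: eq_integral => x _; rewrite big_cons mulrCA.
rewrite H => [|B0 AB0].
  rewrite -[X in (X * _)%E](fineK (x := (\int[P]_x (f p x)%:E)%E)); last first.
    exact: (integrable_fin_num _ (all_moments_integrable (fJ p))).
  by rewrite -EFinM big_cons /k; congr EFin; rewrite mulrCA.
pose B' v := if v == p then B0 else B v.
have pq : p \notin qs by apply: contra pn; rewrite mem_cat => ->; rewrite orbT.
have B'q F : (\prod_(q <- qs) F (B' q) = \prod_(q <- qs) F (B q) :> R).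
  apply: eq_big_seq => q qqs; rewrite /B'; case: eqP => // qp.
  by rewrite -qp qqs in pq.
have := IH (p :: qs) B'.
rewrite !big_cons /B' eqxx -/B'.
transitivity (\int[P]_x ((\prod_(q <- p :: qs) \1_(B' q) x) * \prod_(p <- ps) f p x)%:E)%E.
  apply: eq_integral => x _; rewrite big_cons (B'q (fun Z => \1_Z x)) /B' eqxx.
  by rewrite mulrA.
rewrite IH => [||v|v].
- rewrite big_cons (B'q (fun Z => fine (P Z))) {1}/B' eqxx -mulrA EFinM fineK //.
  by rewrite fin_num_measure //; exact: A_measurable AB0.
- by rewrite -[p :: qs]cat1s (perm_uniq (permEl (perm_catCA _ _ _))) /= pn.
- rewrite mem_cat inE => vps; apply: sD; rewrite inE mem_cat.
  by case/or3P: vps => ->; rewrite ?orbT.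
- by rewrite /B'; case: eqP => // ->.
Qed.

Definition sigma_cmeasurable (G : set (set T)) (f : T -> C) : Prop :=
  sigma_measurable G (fun x => complex.Re (f x)) /\
  sigma_measurable G (fun x => complex.Im (f x)).

Lemma cexpect_prod_indep_aux (ps qs : seq V) (f : V -> T -> C) (g : V -> T -> R) :
  uniq (ps ++ qs) -> {subset ps ++ qs <= D} ->
  (forall v, call_moments P (f v)) -> (forall v, sigma_cmeasurable (A v) (f v)) ->
  (forall v x, 0 <= g v x) -> (forall v, sigma_measurable (A v) (g v)) ->
  (forall v, all_moments P (g v)) ->
  cexpect P (fun x => (\prod_(p <- ps) f p x) * (\prod_(q <- qs) g q x)%:C) =
  (\prod_(p <- ps) cexpect P (f p)) * (\prod_(q <- qs) E (g q))%:C.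
Proof.
move=> + + fJ fA; elim: ps qs g => [|p ps IH] qs g uq sD g0 gA gJ.
  under eq_fun do rewrite big_nil mul1r.
  rewrite big_nil mul1r cexpect_real; congr (_%:C); rewrite /Rintegral.
  have := @integral_prod_indep qs [::] (fun=> set0) g.
  rewrite cats0 big_nil mul1r => /(_ uq sD) H.
  rewrite -[RHS]/(fine _%:E) -H //; last by move=> v; exact: sigma_algebra0.
  by congr fine; apply: eq_integral => x _; rewrite big_nil mul1r.
have /= /andP[pn uq'] := uq.
pose H x := (\prod_(p <- ps) f p x) * (\prod_(q <- qs) g q x)%:C.
pose k := (\prod_(p <- ps) cexpect P (f p)) * (\prod_(q <- qs) E (g q))%:C.
have HJ : call_moments P H.
  apply: call_momentsM; first exact: call_moments_prod.
  under eq_fun do rewrite rmorph_prod; apply: call_moments_prod => q.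
  exact: call_moments_real.
(* Both sides are linear in the factor at [p]. Real and imaginary parts, then positive and negative
   parts, reduce it to a nonnegative function, which can join the product over [qs]. *)
pose Q (u : T -> C) := call_moments P u /\
  cexpect P (fun x => u x * H x) = cexpect P u * k.
have Qlin z u u' : Q u -> Q u' -> Q (fun x => z * u x + u' x).
  move=> [uJ uE] [u'J u'E].
  have zJ (w : T -> C) : call_moments P w -> call_moments P (fun x => z * w x).
    by move=> wJ; apply: call_momentsM => //; exact: call_moments_cst.
  split; first by apply: call_momentsD => //; exact: zJ.
  rewrite cexpectD ?cexpectZ //; last exact: zJ.
  under eq_fun do rewrite mulrDl -mulrA.
  have uHJ := call_momentsM uJ HJ; have u'HJ := call_momentsM u'J HJ.
  by rewrite cexpectD ?cexpectZ // ?uE ?u'E ?mulrDl ?mulrA //; exact: zJ.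
have Qpos (u : T -> R) : (forall x, 0 <= u x) -> sigma_measurable (A p) u ->
    all_moments P u -> Q (fun x => (u x)%:C).
  move=> u0 uA uJ; split; first exact: call_moments_real.
  pose g' v := if v == p then u else g v.
  have pq : p \notin qs by apply: contra pn; rewrite mem_cat => ->; rewrite orbT.
  have g'E (M : Type) (idx : M) op (F : (T -> R) -> M) :
      \big[op/idx]_(q <- qs) F (g' q) = \big[op/idx]_(q <- qs) F (g q).
    apply: eq_big_seq => q qqs; rewrite /g'; case: eqP => // qp.
    by rewrite -qp qqs in pq.
  have g'p : g' p = u by rewrite /g' eqxx.
  have := IH (p :: qs) g'.
  rewrite !big_cons (g'E _ _ _ (fun w => E w)) g'p => IH'.
  rewrite (_ : (fun x => _) = (fun x => (\prod_(p0 <- ps) f p0 x) *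
      (\prod_(q <- p :: qs) g' q x)%:C)).
    rewrite IH'.
    - by rewrite cexpect_real rmorphM mulrCA.
    - by rewrite -[p :: qs]cat1s (perm_uniq (permEl (perm_catCA _ _ _))).
    - move=> v; rewrite mem_cat inE => vps; apply: sD; rewrite inE mem_cat.
      by case/or3P: vps => ->; rewrite ?orbT.
    - by move=> v x; rewrite /g'; case: eqP.
    - by move=> v; rewrite /g'; case: eqP => // ->.
    - by move=> v; rewrite /g'; case: eqP.
  apply: funext => x; rewrite big_cons (g'E _ _ _ (fun w => w x)) g'p.
  by rewrite rmorphM mulrCA.
have Qreal (u : T -> R) : sigma_measurable (A p) u -> all_moments P u ->
    Q (fun x => (u x)%:C).
  move=> uA uJ.
  have uE x : (u x)%:C = (-1) * (Num.max (- u x) 0)%:C + (Num.max (u x) 0)%:C.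
    rewrite mulN1r -rmorphN -rmorphD; congr (_%:C).
    by rewrite /Order.max; case: ltP => ?; case: ltP => ?; lra.
  rewrite (_ : (fun x => _) = (fun x => (-1) * (Num.max (- u x) 0)%:C + (Num.max (u x) 0)%:C)); last first.
    by apply: funext.
  have [mu _] := uJ.
  apply: Qlin; apply: Qpos => [x||].
  - by rewrite le_max lexx orbT.
  - apply: measurable_maxr => //; exact: measurable_funN.
  - apply: (all_moments_le _ _ uJ) => [|x].
      by apply: measurable_maxr => //; exact: measurable_funN.
    by rewrite /Order.max; case: ltP => ?; rewrite ?normr0 ?normrN.
  - by rewrite le_max lexx orbT.
  - exact: measurable_maxr.
  - apply: (all_moments_le _ _ uJ) => [|x].
      exact: measurable_maxr.
    by rewrite /Order.max; case: ltP => ?; rewrite ?normr0.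
have [_ QE] : Q (f p).
  rewrite (_ : f p = (fun x => 'i%C * (complex.Im (f p x))%:C + (complex.Re (f p x))%:C)).
    have [fR fI] := fJ p; have [fRA fIA] := fA p.
    by apply: Qlin; exact: Qreal.
  by apply: funext => x; rewrite addrC; exact: complexE.
rewrite big_cons -mulrA -/k -QE; congr cexpect; apply: funext => x.
by rewrite big_cons /H mulrA.
Qed.

Lemma cexpect_prod_indep (f : V -> T -> C) :
  (forall v, call_moments P (f v)) -> (forall v, sigma_cmeasurable (A v) (f v)) ->
  cexpect P (fun x => \prod_(v in D) f v x) = \prod_(v in D) cexpect P (f v).
Proof.
move=> fJ fA.
have := @cexpect_prod_indep_aux (enum D) [::] f (fun=> cst 0); rewrite cats0.
under eq_fun do rewrite big_nil mulr1.
rewrite big_nil mulr1 big_enum /= => <- //.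
- by congr cexpect; apply: funext => x; rewrite big_enum.
- exact: enum_uniq.
- by move=> v; rewrite mem_enum.
- by move=> v; exact: measurable_cst.
- by move=> v; exact: all_moments_cst.
Qed.

End Independence.

(** * Joint moments of the entries *)

Section EntryMoments.
Context d (T : measurableType d) (R : realType) (P : probability T R).
Notation C := (R[i]).
Variables (L : eqType) (N : nat) (Y : L -> 'M[T -> C]_N).
Notation edge := (L * 'I_N * 'I_N)%type.

Definition entry (x : edge) : T -> C := Y x.1.1 x.1.2 x.2.
Definition entry_moment (t : seq edge) : C := cexpect P (\prod_(x <- t) entry x).

Lemma fct_prodE (A : Type) (r : seq A) (f : A -> T -> C) (p : pred A) :
  \prod_(a <- r | p a) f a = (fun x => \prod_(a <- r | p a) f a x).
Proof. by apply: funext => x; elim/big_rec2: _ => //= a y1 y2 _ <-. Qed.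

Lemma entry_moment_nil : entry_moment [::] = 1.
Proof. by rewrite /entry_moment big_nil; exact: cexpect_cst. Qed.

Lemma entry_moment_perm (t1 t2 : seq edge) :
  perm_eq t1 t2 -> entry_moment t1 = entry_moment t2.
Proof. by move=> t12; rewrite /entry_moment (perm_big _ t12). Qed.

Hypothesis Y_Linfm : forall l i j, Linfm P (Y l i j).

Lemma call_moments_entry x : call_moments P (entry x).
Proof. exact: Linfm_call_moments (Y_Linfm _ _ _). Qed.

Lemma call_moments_entries (t : seq edge) : call_moments P (\prod_(x <- t) entry x).
Proof.
by rewrite fct_prodE; apply: call_moments_prod => x; exact: call_moments_entry.
Qed.

Lemma cexpect_ae (f g : T -> C) : call_moments P f -> call_moments P g ->
  {ae P, forall x, f x = g x} -> cexpect P f = cexpect P g.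
Proof.
move=> [[fR _] [fI _]] [[gR _] [gI _]] fg; rewrite /cexpect /Rintegral.
congr (fine _ +i* fine _); apply: ae_eq_integral => //; try exact/measurable_EFinP.
  by apply: filterS fg => x /= ->.
by apply: filterS fg => x /= ->.
Qed.

Section Independent.
Hypothesis Y_selfadjoint : forall l i j,
  {ae P, forall w, Y l j i w = Num.conj (Y l i j w)}.
Hypothesis Y_independent :
  independent_sets P [set p : 'I_N * 'I_N | (p.1 <= p.2)%N]%SET
    (fun p => [set f | exists l, f = Y l p.1 p.2]).

Let pair_of (x : edge) : 'I_N * 'I_N :=
  if (x.1.2 <= x.2)%N then (x.1.2, x.2) else (x.2, x.1.2).

(* Almost surely equal to [entry x], but a function of the entry above the
   diagonal. *)
Let upper_entry (x : edge) : T -> C :=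
  if (x.1.2 <= x.2)%N then entry x else fun w => Num.conj (Y x.1.1 x.2 x.1.2 w).

Let generators (p : 'I_N * 'I_N) : set (set T) :=
  \bigcup_(f in [set f | exists l, f = Y l p.1 p.2])
     (preimage_set_system setT (fun w => complex.Re (f w)) measurable `|`
      preimage_set_system setT (fun w => complex.Im (f w)) measurable).

Let generators_measurable p : <<s generators p >> `<=` measurable.
Proof.
apply: smallest_sub; first exact: sigma_algebra_measurable.
move=> B [_ [l ->]] [[Y0 mY0 <-]|[Y0 mY0 <-]].
  by have [mR _ _] := Y_Linfm l p.1 p.2; exact: mR.
by have [_ mI _] := Y_Linfm l p.1 p.2; exact: mI.
Qed.

Let sigma_cmeasurable_Y l p : sigma_cmeasurable (generators p) (Y l p.1 p.2).
Proof.
split=> _ Y0 mY0; apply: sub_sigma_algebra; exists (Y l p.1 p.2).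
- by exists l.
- by left; exists Y0.
- by exists l.
- by right; exists Y0.
Qed.

Let sigma_cmeasurable_upper x : sigma_cmeasurable (generators (pair_of x)) (upper_entry x).
Proof.
rewrite /pair_of /upper_entry; case: ifP => _.
  exact: (sigma_cmeasurable_Y x.1.1 (x.1.2, x.2)).
have [mR mI] := sigma_cmeasurable_Y x.1.1 (x.2, x.1.2).
have RE z : complex.Re (Num.conj z) = complex.Re z :> R by case: z.
have IE z : complex.Im (Num.conj z) = - complex.Im z :> R by case: z.
split; rewrite /sigma_measurable; under eq_fun do rewrite ?RE ?IE; first exact: mR.
exact: measurable_funN.
Qed.

Let sigma_cmeasurable_block (t : seq edge) p :
  sigma_cmeasurable (generators p) (\prod_(x <- t | pair_of x == p) upper_entry x).
Proof.
elim: t => [|x t IH].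
  by rewrite big_nil; split; exact: measurable_cst.
rewrite big_cons; case: eqP => // xp.
have [fR fI] := sigma_cmeasurable_upper x; have [gR gI] := IH; rewrite xp in fR fI.
set g := \prod_(_ <- _ | _) _ in gR gI *.
have E w : upper_entry x w * g w =
  (complex.Re (upper_entry x w) * complex.Re (g w) - complex.Im (upper_entry x w) * complex.Im (g w)) +i*
  (complex.Re (upper_entry x w) * complex.Im (g w) + complex.Im (upper_entry x w) * complex.Re (g w)).
  by case: (upper_entry x w) => a b; case: (g w) => a' b'.
split; rewrite /sigma_measurable.
  rewrite (_ : (fun w => _) = (fun w => complex.Re (upper_entry x w) * complex.Re (g w) - complex.Im (upper_entry x w) * complex.Im (g w))).
    by apply: measurable_funB; apply: measurable_funM.
  by apply: funext => w; rewrite -[(_ * _) w]/(_ w * _ w) E.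
rewrite (_ : (fun w => _) = (fun w => complex.Re (upper_entry x w) * complex.Im (g w) + complex.Im (upper_entry x w) * complex.Re (g w))).
  by apply: measurable_funD; apply: measurable_funM.
by apply: funext => w; rewrite -[(_ * _) w]/(_ w * _ w) E.
Qed.

Let call_moments_upper x : call_moments P (upper_entry x).
Proof.
rewrite /upper_entry; case: ifP => _; first exact: call_moments_entry.
have [mR mI] := call_moments_entry (x.1.1, x.2, x.1.2).
split.
  rewrite (_ : (fun w => _) = (fun w => complex.Re (Y x.1.1 x.2 x.1.2 w))) //.
  by apply: funext => w; case: (Y _ _ _ w).
have IE w : complex.Im (Num.conj (Y x.1.1 x.2 x.1.2 w)) = - complex.Im (Y x.1.1 x.2 x.1.2 w).
  by case: (Y _ _ _ w).
by under eq_fun do rewrite IE; exact: all_momentsN.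
Qed.

(** Replacing entries below the diagonal by conjugates changes them on a null set only; grouping by
    [pair_of] then gives functions of independent sets of variables. *)
Let entry_momentE (t : seq edge) : entry_moment t =
  \prod_(p in [set p : 'I_N * 'I_N | (p.1 <= p.2)%N]%SET)
    cexpect P (\prod_(x <- t | pair_of x == p) upper_entry x).
Proof.
have blockJ p : call_moments P (\prod_(x <- t | pair_of x == p) upper_entry x).
  rewrite fct_prodE; under eq_fun do rewrite -big_filter.
  by apply: call_moments_prod => x; exact: call_moments_upper.
rewrite -(cexpect_prod_indep generators_measurable Y_independent blockJ); last first.
  by move=> p; exact: sigma_cmeasurable_block.
rewrite (_ : (fun w => _) = \prod_(x <- t) upper_entry x); last first.
  apply: funext => w; rewrite !fct_prodE.
  rewrite (partition_big pair_of (fun p => p \in [set p : 'I_N * 'I_N | (p.1 <= p.2)%N]%SET)).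
    by apply: eq_bigr => p _; rewrite fct_prodE.
  move=> x _; rewrite inE /pair_of; case: ifP => //= /negbT.
  by rewrite -ltnNge => /ltnW.
apply: cexpect_ae; first exact: call_moments_entries.
  by rewrite fct_prodE; apply: call_moments_prod => x; exact: call_moments_upper.
elim: t {blockJ} => [|x t IH]; first by rewrite !big_nil; exact: (aeW P (fun=> erefl)).
have xx : {ae P, forall w, entry x w = upper_entry x w}.
  rewrite /upper_entry; case: ifP => _; first exact: (aeW P (fun=> erefl)).
  exact: Y_selfadjoint.
by rewrite !big_cons; apply: filterS2 xx IH => w /= E1 E2; rewrite !mulrfctE E1 E2.
Qed.

(** [key] and [pair_of] determine each other, so for each pair at least one of the two lists
    contributes an empty block, of expectation 1. *)
Lemma entry_moment_cat (t1 t2 : seq edge) : [disjoint keys t1 & keys t2]%B ->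
  entry_moment (t1 ++ t2) = entry_moment t1 * entry_moment t2.
Proof.
move=> dis; rewrite !entry_momentE -big_split; apply: eq_bigr => p _ /=.
have keyE x : key x = [set (pair_of x).1; (pair_of x).2]%SET.
  by rewrite /key /pair_of; case: ifP => //= _; rewrite finset.setUC.
have none t : [set p.1; p.2]%SET \notin keys t ->
    \prod_(x <- t | pair_of x == p) upper_entry x = 1.
  move=> pt; rewrite big_seq_cond big1 // => x /andP[xt /eqP xp].
  by case/negP: pt; rewrite -xp -keyE mem_keys map_f.
rewrite big_cat /=; have [p1|p1] := boolP ([set p.1; p.2]%SET \in keys t1).
  rewrite (none t2) ?mulr1; last by rewrite (disjointFr dis p1).
  by rewrite [X in _ * X](_ : _ = 1) ?mulr1 //; exact: cexpect_cst.
rewrite (none t1) // mul1r [X in X * _](_ : _ = 1) ?mul1r //.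
exact: cexpect_cst.
Qed.

End Independent.
End EntryMoments.

(** * From moments on a single pair to all joint moments *)

Section BlockBound.
Variables (F : numFieldType) (L : eqType).
Notation edge N := (L * 'I_N * 'I_N)%type.
Variable e : forall N, seq (edge N) -> F.
Arguments e : clear implicits.
Hypothesis e_nil : forall N, e N [::] = 1.
Hypothesis e_perm : forall N (t1 t2 : seq (edge N)), perm_eq t1 t2 -> e N t1 = e N t2.
Hypothesis e_cat : forall N (t1 t2 : seq (edge N)), [disjoint keys t1 & keys t2]%B ->
  e N (t1 ++ t2) = e N t1 * e N t2.
Variable s : nat -> F.
Hypothesis s_ge0 : forall N, 0 <= s N.
Hypothesis block_bound : forall ls : seq L, exists (C : F) (N0 : nat), 0 <= C /\
  forall N, (N0 < N)%N -> forall t : seq (edge N), map label t = ls ->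
    (forall x y, x \in t -> y \in t -> key x = key y) ->
    `|e N t| <= C * s N ^- size ls.

(** The edges on the pair of the first one are split off, leaving a shorter list. Their positions
    depend on the walk but form one of finitely many masks; summing the constants over all masks
    makes the bound uniform in $N$ and in the walk. *)
Lemma bound_of_blocks (ls : seq L) : exists (C : F) (N0 : nat), 0 <= C /\
  forall N, (N0 < N)%N -> forall t : seq (edge N), map label t = ls ->
    `|e N t| <= C * s N ^- size ls.
Proof.
have [n] := ubnP (size ls); elim: n ls => // n IHn [|l ls] ltn.
  exists 1, 0%N; split=> // N _ [|//] _.
  by rewrite e_nil normr1 expr0 invr1 mulr1.
have H (b : (size ls).-tuple bool) : exists CN : F * nat, 0 <= CN.1 /\
    forall N, (CN.2 < N)%N -> forall t1 t2 : seq (edge N),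
    map label t1 = l :: mask b ls -> map label t2 = mask (map negb b) ls ->
    (forall x y, x \in t1 -> y \in t1 -> key x = key y) ->
    `|e N t1 * e N t2| <= CN.1 * s N ^- (size ls).+1.
  have [C1 [N1 [C10 H1]]] := block_bound (l :: mask b ls).
  have szb : (size (mask b ls) + size (mask (map negb b) ls) = size ls)%N.
    rewrite !size_mask ?size_map ?size_tuple // count_map.
    by apply: etrans (size_tuple b); rewrite -(count_predC id b); congr addn; exact: eq_count.
  have [|C2 [N2 [C20 H2]]] := IHn (mask (map negb b) ls).
    by move: ltn => /=; lia.
  exists (C1 * C2, maxn N1 N2); split; first exact: mulr_ge0.
  move=> N /=; rewrite gtn_max => /andP[N1N N2N] t1 t2 t1l t2l t1k.
  have -> : s N ^- (size ls).+1 =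
      s N ^- (size (mask b ls)).+1 * s N ^- size (mask (map negb b) ls).
    by rewrite -invfM -exprD addSn szb.
  rewrite normrM mulrACA; apply: ler_pM => //.
    by have := H1 N N1N t1 t1l t1k.
  exact: H2.
have [CN HCN] := fin_all_exists H.
exists (\sum_b (CN b).1), (\max_b (CN b).2); split.
  by apply: sumr_ge0 => b _; case: (HCN b).
move=> N NN [//|x t] /= [xl tl].
pose same (y : edge N) := key y == key x.
pose b := map same t.
have szb : size b == size ls by rewrite size_map -tl size_map.
have [_ Hb] := HCN (Tuple szb).
have negbE : map negb b = map (predC same) t by rewrite -map_comp.
rewrite (@e_perm N _ ((x :: seq.filter same t) ++ seq.filter (predC same) t)); last first.
  by rewrite /= perm_cons perm_sym (permEl (perm_filterC _ _)).
rewrite e_cat; last first.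
  rewrite finset.disjoints_subset; apply/fintype.subsetP => k; rewrite keys_cons finset.in_setU1.
  have E y : y \in seq.filter same t -> key y = key x by rewrite mem_filter => /andP[/eqP].
  move=> kx; have {kx} -> : k = key x.
    by case/orP: kx => [/eqP//|]; rewrite mem_keys => /mapP[y /E <-].
  rewrite finset.in_setC mem_keys; apply/negP => /mapP[y].
  by rewrite mem_filter /= /same => /andP[/negP yx _] xy; apply: yx; rewrite xy.
apply: le_trans (Hb N _ _ _ _ _ _) _.
- by apply: leq_ltn_trans NN; exact: leq_bigmax.
- by rewrite /= xl filter_mask map_mask tl.
- by rewrite filter_mask map_mask tl negbE.
- move=> y z; rewrite !inE !mem_filter => yt zt.
  have E w : (w == x) || same w && (w \in t) -> key w = key x.
    by case/orP => [/eqP->|/andP[/eqP]].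
  by rewrite (E _ yt) (E _ zt).
rewrite ler_wpM2r ?invr_ge0 ?exprn_ge0 // (bigD1 (Tuple szb)) //= lerDl.
by apply: sumr_ge0 => c _; case: (HCN c).
Qed.
End BlockBound.

(** * Traces of words as sums over walks *)

Section Trace.
Context d (T : measurableType d) (R : realType) (P : probability T R).
Notation C := (R[i]).
Variables (L : eqType) (D : Type) (N : nat) (Y : L -> 'M[T -> C]_N) (dm : D -> 'rV[C]_N).
Notation V := (L + D)%type.
Hypothesis Y_Linfm : forall l i j, Linfm P (Y l i j).

Definition letter (v : V) : 'M[T -> C]_N :=
  match v with inl l => Y l | inr x => mx_cst T (diag_mx (dm x)) end.

Lemma cexpect_fct_sum (f : 'I_N -> T -> C) : (forall k, call_moments P (f k)) ->
  cexpect P (\sum_k f k) = \sum_k cexpect P (f k).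
Proof. by move=> fJ; rewrite -cexpect_sum // fct_sumE. Qed.

Lemma call_moments_fctM (f g : T -> C) : call_moments P f -> call_moments P g ->
  call_moments P (f * g).
Proof. exact: call_momentsM. Qed.

Lemma call_moments_word (w : seq V) i j : call_moments P ((\prod_(v <- w) letter v) i j).
Proof.
elim: w i j => [|v w IHw] i j.
  rewrite big_nil mxE; case: eqP => _; exact: call_moments_cst.
rewrite big_cons -[(_ * _)%R]/(_ *m _) mxE fct_sumE.
apply: call_moments_sum => k; apply: call_momentsM => //.
case: v => [l|x] /=; first exact: (Linfm_call_moments (Y_Linfm _ _ _)).
by rewrite mxE; exact: call_moments_cst.
Qed.

(** The random entries read so far are collected in [h], as they cannot leave the expectation before
    the word is exhausted. *)
Lemma cexpect_word (w : seq V) i j (h : T -> C) : call_moments P h ->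
  cexpect P (h * (\prod_(v <- w) letter v) i j) =
  psum (fun x i => dm x 0 i) w i j
    (fun t => cexpect P (h * \prod_(x <- t) entry Y x)).
Proof.
elim: w i h => [|[l|x] w IHw] i h hJ /=.
- rewrite !big_nil mxE; case: eqP => _; first by rewrite mul1r.
  rewrite mul0r (_ : h * _ = cst 0) ?cexpect_cst //.
  by apply: funext => w; exact: mulr0.
- rewrite big_cons -[letter _ * _]/(_ *m _) mxE mulr_sumr cexpect_fct_sum => [|k]; last first.
    apply: (call_moments_fctM hJ); apply: call_moments_fctM; last exact: call_moments_word.
    exact: (Linfm_call_moments (Y_Linfm _ _ _)).
  apply: eq_bigr => k _; rewrite mulrA IHw; last first.
    by apply: (call_moments_fctM hJ); exact: (Linfm_call_moments (Y_Linfm _ _ _)).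
  by apply: eq_psum => t _ _; rewrite big_cons mulrA.
- rewrite big_cons -[letter _ * _]/(_ *m _) mxE (bigD1 i) //= [X in _ + X]big1 => [|k ki]; last first.
    by rewrite /letter /mx_cst !mxE eq_sym (negbTE ki) mulr0n; apply: funext => w'; exact: mul0r.
  rewrite addr0 /mx_cst !mxE eqxx mulr1n mulrCA -IHw //.
  by rewrite -cexpectZ //; apply: (call_moments_fctM hJ); exact: call_moments_word.
Qed.

Lemma phi_mx_word (w : seq V) :
  phi_mx P (\prod_(v <- w) letter v) =
  tsum (fun x i => dm x 0 i) [:: w] (entry_moment P Y).
Proof.
rewrite /phi_mx /=; congr (_ * _); apply: eq_bigr => i _.
rewrite -[X in cexpect P X]mul1r cexpect_word; last exact: call_moments_cst.
by apply: eq_psum => t _ _; rewrite mul1r cats0.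
Qed.

Lemma ntrace_diag_word (u : seq D) :
  ntrace (\prod_(x <- u) diag_mx (dm x)) = N%:R^-1 * \sum_i \prod_(x <- u) dm x 0 i.
Proof.
rewrite /ntrace /mxtrace; congr (_ * _); apply: eq_bigr => i _.
have -> : \prod_(x <- u) diag_mx (dm x) = diag_mx (\row_k \prod_(x <- u) dm x 0 k).
  elim: u => [|x u IH].
    by apply/matrixP => a b; rewrite big_nil !mxE big_nil.
  rewrite big_cons IH -[(_ * _)%R]/(_ *m _) mulmx_diag; congr diag_mx.
  by apply/rowP => k; rewrite !mxE big_cons.
by rewrite !mxE eqxx.
Qed.
End Trace.

Section SquareRoot.
Variable R : realType.

Definition csqrt_nat (N : nat) : R[i] := (Num.sqrt N%:R)%:C.

Lemma csqrt_nat_ge0 N : 0 <= csqrt_nat N.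
Proof. by rewrite lecR sqrtr_ge0. Qed.

Lemma csqrt_nat_sqr N : csqrt_nat N ^+ 2 = N%:R.
Proof. by rewrite -rmorphXn /= sqr_sqrtr // rmorph_nat. Qed.

Lemma powR_csqrt_nat (N m : nat) : (N%:R `^ (- (m%:R / 2)))%:C = csqrt_nat N ^- m.
Proof.
rewrite powRN fmorphV; congr (_^-1).
by rewrite mulrC powRrM powR12_sqrt // powR_mulrn ?sqrtr_ge0 // rmorphXn.
Qed.

Lemma cvg_csqrt_natV : (fun N => (csqrt_nat N)^-1 : (R[i] : numFieldType)) @ \oo --> (0 : (R[i] : numFieldType)).
Proof.
(* A positive element of [R[i]] is real, hence [b = 0]. *)
apply/cvgr0Pnorm_lt => -[a b]; rewrite ltcE /= => /andP[/eqP b0 a0]; subst b.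
exists (Num.bound (a ^- 2)).+1 => // N /= aN.
have N0 : 0 < (N%:R : R) by rewrite ltr0n (leq_trans _ aN).
have aN' : a ^- 2 < N%:R.
  apply: lt_le_trans (_ : (Num.bound (a ^- 2))%:R <= _).
    by apply: archi_boundP; rewrite invr_ge0 exprn_ge0 // ltW.
  by rewrite ler_nat ltnW.
rewrite ger0_norm ?invr_ge0 ?csqrt_nat_ge0 // -fmorphV /= ltcR.
rewrite invf_plt ?posrE ?sqrtr_gt0 // -[a^-1]ger0_norm ?invr_ge0 ?ltW //.
by rewrite -sqrtr_sqr ltr_sqrt // exprVn.
Qed.
End SquareRoot.

Section BlockBound.
Context d (T : measurableType d) (R : realType) (P : probability T R).
Notation C := (R[i]).
Variables (I J K : Type) (Y : forall N : nat, I + J -> K -> 'M[T -> C]_N).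
Hypothesis Y_moments : forall (m : nat) (chi : 'I_m -> I + J) (eps : 'I_m -> K),
  exists (M : R) (N0 : nat), 0 < M /\
    forall N : nat, (N0 < N)%N ->
    forall i j : 'I_N, (i <= j)%N ->
    forall lam tau : 'I_m -> 'I_N,
      (forall r, (lam r, tau r) = (i, j) \/ (lam r, tau r) = (j, i)) ->
      `|cexpect P (\prod_(r < m) Y N (chi r) (eps r) (lam r) (tau r))|
        <= (M * N%:R `^ (- (m%:R / 2)))%:C.
Notation L := {classic (I + J) * K}.
Notation edge N := (L * 'I_N * 'I_N)%type.

Lemma entry_moment_block_bound (ls : seq L) : exists (C0 : C) (N0 : nat), 0 <= C0 /\
  forall N, (N0 < N)%N -> forall t : seq (edge N), map label t = ls ->
    (forall x y, x \in t -> y \in t -> key x = key y) ->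
    `|entry_moment P (fun lk : L => Y N lk.1 lk.2) t| <= C0 * csqrt_nat R N ^- size ls.
Proof.
case: ls => [|l0 ls].
  exists 1, 0%N; split=> // N _ [|//] _ _.
  by rewrite entry_moment_nil normr1 expr0 invr1 mulr1.
have [M [N0 [M0 H]]] := Y_moments (fun r : 'I_(size (l0 :: ls)) => (nth l0 (l0 :: ls) r).1)
  (fun r => (nth l0 (l0 :: ls) r).2).
exists M%:C, N0; split=> [|N NN [//|x0 t] tl tk]; first by rewrite lecR ltW.
set t0 := x0 :: t in tl tk *.
have sz : size t0 = size (l0 :: ls) by rewrite -tl size_map.
pose lam (r : 'I_(size (l0 :: ls))) := (nth x0 t0 r).1.2.
pose tau (r : 'I_(size (l0 :: ls))) := (nth x0 t0 r).2.
have E : entry_moment P (fun lk : L => Y N lk.1 lk.2) t0 =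
    cexpect P (\prod_(r < size (l0 :: ls)) Y N (nth l0 (l0 :: ls) r).1 (nth l0 (l0 :: ls) r).2 (lam r) (tau r)).
  rewrite /entry_moment (big_nth x0) sz big_mkord; congr cexpect; apply: eq_bigr => r _.
  have -> : nth l0 (l0 :: ls) r = label (nth x0 t0 r).
    by rewrite -(nth_map x0 l0 label) ?sz // tl.
  by [].
rewrite E -powR_csqrt_nat -rmorphM.
have kr r : [set lam r; tau r]%SET = [set x0.1.2; x0.2]%SET.
  by apply: (tk (nth x0 t0 r) x0); rewrite ?mem_nth ?sz // inE eqxx.
(* The moment bound is available for [i <= j] only, so the common pair is oriented accordingly. *)
have [le|/ltnW le] := leqP x0.1.2 x0.2; apply: (H N NN _ _ le) => r.
  by case: (set2_inj (kr r)); auto.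
by case: (set2_inj (kr r)); auto.
Qed.
End BlockBound.

Theorem theorem2p6 (R : realType) (disp : measure_display)
  (Omega : measurableType disp) (mu : probability Omega R)
  (I J K K' : Type)
  (c : K -> I + J -> I + J -> R)
  (c_posdef : forall k, posdef_kernel (fun l1 l2 => (c k l1 l2)%:C))
  (Y : forall N : nat, I + J -> K -> 'M[Omega -> R[i]]_N)
  (Y_Linfm : forall N l k i j, Linfm mu (Y N l k i j))
  (Y_centered : forall N l k i j, cexpect mu (Y N l k i j) = 0)
  (Y_selfadjoint : forall N l k i j,
     {ae mu, forall w, Y N l k j i w = Num.conj (Y N l k i j w)})
  (Y_independent : forall N : nat,
     independent_sets mu [set p : 'I_N * 'I_N | (p.1 <= p.2)%N]%SET
       (fun p => [set f | exists l k, f = Y N l k p.1 p.2]))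
  (Y_covariance : forall (N : nat) (i j : 'I_N) l1 l2 k,
     cexpect mu (Y N l1 k i j * Y N l2 k j i) = N%:R^-1 * (c k l1 l2)%:C)
  (Y_uncorrelated : forall (N : nat) (i j : 'I_N) l1 l2 k1 k2, k1 <> k2 ->
     cexpect mu (Y N l1 k1 i j * Y N l2 k2 j i) = 0)
  (Y_moments : forall (m : nat) (chi : 'I_m -> I + J) (eps : 'I_m -> K),
     exists (M : R) (N0 : nat), 0 < M /\
       forall N : nat, (N0 < N)%N ->
       forall i j : 'I_N, (i <= j)%N ->
       forall lam tau : 'I_m -> 'I_N,
         (forall r, (lam r, tau r) = (i, j) \/ (lam r, tau r) = (j, i)) ->
         `|cexpect mu (\prod_(r < m) Y N (chi r) (eps r) (lam r) (tau r))|
           <= (M * N%:R `^ (- (m%:R / 2)))%:C)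
  (D : forall N : nat, K' -> 'rV[R[i]]_N)
  (A : ncProbSpace R) (A_tracial : tracial A) (d : K' -> A)
  (D_cvg : cvg_in_distribution (M := fun N => 'M[R[i]]_N)
             (fun N => @ntrace R N) (fun N k' => diag_mx (D N k')) d)
  (D_bounded : forall k', exists M : R, forall (N : nat) (i : 'I_N),
     `|D N k' 0 i| <= M%:C) :
  exists (B : ncProbSpace R) (s : I + J -> K -> B) (d' : K' -> B),
    [/\ (forall w : seq K',
           nc_state B (\prod_(k' <- w) d' k') = nc_state A (\prod_(k' <- w) d k')),
        cvg_in_distribution (M := fun N => 'M[Omega -> R[i]]_N)
          (fun N => @phi_mx disp Omega R mu N)
          (fun N (v : (I + J) * K + K') => match v with
             | inl (l, k) => Y N l k
             | inr k' => mx_cst Omega (diag_mx (D N k'))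
             end)
          (fun v : (I + J) * K + K' => match v with
             | inl (l, k) => s l k
             | inr k' => d' k'
             end) &
        free_family (fun v : option K => match v with
          | Some k => [set s (inl i) k | i in [set: I]] `|`
                      [set s (inr j) k | j in [set: J]]
          | None => [set d' k' | k' in [set: K']]
          end)].
Proof.
(* [{classic}] supplies equality and choice on arbitrary index types. A label is an element of
   [I + J] together with its [k], and [k] serves as the colour. *)
pose L : choiceType := {classic (I + J) * K}.
pose YL N (lk : L) := Y N lk.1 lk.2.
(* Covariance on all labels at once: its vanishing for distinct [k] is what makes the families for
   different [k] free. *)
pose cL (l l' : L) : R[i] := if `[< l.2 = l'.2 >] then (c l.2 l.1 l'.1)%:C else 0.
have YL_Linfm N (l : L) i j : Linfm mu (YL N l i j) by exact: Y_Linfm.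
pose e N := entry_moment mu (YL N).
have e_nil N : e N [::] = 1 by exact: entry_moment_nil.
have e_perm N t1 t2 : perm_eq t1 t2 -> e N t1 = e N t2 by exact: entry_moment_perm.
have e_cat N (t1 t2 : seq (L * 'I_N * 'I_N)) : [disjoint keys t1 & keys t2]%B ->
    e N (t1 ++ t2) = e N t1 * e N t2.
  apply: entry_moment_cat => [|l i j|]; [exact: YL_Linfm | exact: Y_selfadjoint |].
  rewrite (_ : (fun p => _) = (fun p => [set f | exists l k, f = Y N l k p.1 p.2])) //.
  apply: funext => p; apply/seteqP; split=> f /= => [[[l k] ->]|[l [k ->]]].
    by exists l, k.
  by exists (l, k).
have e_seq1 N x : e N [:: x] = 0.
  by rewrite /e /entry_moment big_seq1; exact: Y_centered.
have e_pair N (l l' : L) i j : e N [:: (l, i, j); (l', j, i)] = N%:R^-1 * cL l l'.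
  rewrite /e /entry_moment !big_cons big_nil mulr1 /cL; case: asboolP => [ll'|ll'].
    by rewrite /entry /YL /= -ll'; exact: Y_covariance.
  by rewrite mulr0; exact: Y_uncorrelated.
have s_ge0 := @csqrt_nat_ge0 R; have s_sqr := @csqrt_nat_sqr R.
have e_bound := bound_of_blocks e_nil e_perm e_cat s_ge0
  (entry_moment_block_bound Y_moments).
have [M0 HM0] := choice D_bounded.
pose Md x : R[i] := `|M0 x|%:C.
have Md_ge0 x : 0 <= Md x by rewrite lecR.
pose dm N x i := D N x 0 i.
have d_le N x i : `|dm N x i| <= Md x.
  by apply: le_trans (HM0 x N i) _; rewrite lecR ler_norm.
pose lim_d u := nc_state A (\prod_(x <- u) d x).
have d_cvg u : ((fun N => N%:R^-1 * \sum_i \prod_(x <- u) dm N x i : (R[i] : numFieldType))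
    @ \oo --> (lim_d u : (R[i] : numFieldType)))%classic.
  have := D_cvg u; rewrite /ccvg.
  by under eq_fun do rewrite ntrace_diag_word.
pose m : seq (L + K') -> R[i] := limit_moment dm e.
have m_cvg w := cvg_limit_moment Md_ge0 d_le e_nil e_perm e_cat e_seq1 e_pair s_ge0 s_sqr
  e_bound (@cvg_csqrt_natV R) d_cvg w.
have m_inr := limit_moment_inr e_nil d_cvg.
have m_SD := limit_moment_schwinger_dyson Md_ge0 d_le e_nil e_perm e_cat e_seq1 e_pair
  s_ge0 s_sqr e_bound (@cvg_csqrt_natV R) d_cvg.
have m1 : m [::] = 1.
  by have := m_inr [::]; rewrite /lim_d big_nil nc_state1.
pose V : choiceType := {classic (I + J) * K + K'}.
have st1 : @free_state R[i] V m 1 = 1.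
  by have := @free_state_prod R[i] V m [::]; rewrite big_nil m1.
pose B := @NCProbSpace R (free_alg R[i] V) (@free_state R[i] V m) st1.
pose gen (v : V) : B := free_gen R[i] v.
have genE (w : seq V) : nc_state B (\prod_(v <- w) gen v) = m w.
  exact: free_state_prod.
exists B, (fun l k => gen (inl (l, k))), (fun k' => gen (inr k')); split.
- move=> w; rewrite -[RHS]/(lim_d w) -m_inr -/m -genE.
  by congr (nc_state B _); rewrite big_map.
- move=> w.
  rewrite (eq_bigr gen) => [|[[l k]|k'] _ //]; rewrite genE.
  have := m_cvg w; rewrite /ccvg /trace_moment.
  rewrite (_ : (fun N => tsum _ _ _) = (fun N => phi_mx mu (\prod_(v <- w)
    match v with inl (l, k) => Y N l k | inr k' => mx_cst Omega (diag_mx (D N k')) end))) //.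
  apply: funext => N; rewrite -phi_mx_word //; congr phi_mx.
  by apply: eq_bigr => -[[l k]|k'] _.
- apply: (free_family_alternating (col := fun l : (I + J) * K => l.2) (x := gen) genE).
    move=> ws; apply: cexp_alternating; [exact: m1 | exact: m_SD |].
    by move=> l l'; rewrite /cL; case: asboolP; auto.
  move=> [k|] b /=; last by case=> k' _ <-; exists (inr k').
  by case=> -[i _ <-]; [exists (inl (inl i, k)) | exists (inl (inr i, k))].
Qed.
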